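(* Let $G$ be a minimal $2$-extendable claw-free graph. Then its minimum degree satisfies $\delta(G)=4$ or $\delta(G)=5$.
   Context: All graphs are finite, undirected and simple. For an integer $k$ with $1\le k\le \frac{|V(G)|}{2}-1$, a connected graph $G$ with a perfect matching is $k$-extendable if every matching of $G$ of size $k$ is contained in a perfect matching of $G$. A $k$-extendable graph $G$ is minimal if for every edge $e\in E(G)$ the graph $G-e$ is not $k$-extendable. A graph is claw-free if it has no induced subgraph isomorphic to $K_{1,3}$. $\delta(G)$ denotes the minimum degree of $G$. *)

(* Defs.v *)
From mathcomp Require Import all_boot.

Set Implicit Arguments.
Unset Strict Implicit.
Unset Printing Implicit Defensive.

(* A finite simple graph is a symmetric irreflexive relation [e] on a finite
   vertex type; its edges are the two-element vertex sets [set x; y] with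
   [e x y]. *)
Section Graphs.
Variables (T : finType) (e : rel T).

Definition edges : {set {set T}} :=
  [set [set p.1; p.2] | p : T * T & e p.1 p.2].

Definition del_edge (f : {set T}) : rel T :=
  [rel x y | e x y && ([set x; y] != f)].

Definition connected : bool := [forall x, forall y, connect e x y].

Definition matching (M : {set {set T}}) : bool :=
  (M \subset edges) && trivIset M.

Definition perfect_matching (M : {set {set T}}) : bool :=
  matching M && (cover M == [set: T]).

(* The second conjunct is k <= #|T| / 2 - 1, freed of division and of
   truncated subtraction. *)
Definition extendable (k : nat) : bool :=
  [&& 0 < k, 2 * (k + 1) <= #|T|, connected,
      [exists M, perfect_matching M] &
      [forall M, (matching M && (#|M| == k)) ==>
         [exists N : {set {set T}}, perfect_matching N && (M \subset N)]]].

Definition degree (x : T) : nat := #|[set y | e x y]|.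

(* Every degree is less than #|T|, so the default value #|T| never wins
   when T is nonempty. *)
Definition min_degree : nat := \big[minn/#|T|]_(x : T) degree x.

End Graphs.

Definition minimal_extendable (T : finType) (e : rel T) (k : nat) : bool :=
  extendable e k && [forall f in edges e, ~~ extendable (del_edge e f) k].

Definition complete_bipartite m n : rel ('I_m + 'I_n)%type :=
  [rel u v | match u, v with
             | inl _, inr _ | inr _, inl _ => true
             | _, _ => false
             end].

Arguments complete_bipartite : clear implicits.

Definition induced_subgraph (S T : finType) (s : rel S) (e : rel T) : Prop :=
  exists2 h : S -> T, injective h & forall u v : S, e (h u) (h v) = s u v.

Definition claw_free (T : finType) (e : rel T) : Prop :=
  ~ induced_subgraph (complete_bipartite 1 3) e.

(* Main.v *)
(** In a claw-free graph [A] has a perfect matching as soon as every union of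
    components of [A] is even (Sumner), so no Tutte-type theorem is needed.

    [delta >= 4]: a vertex [x] of degree at most 3 can be isolated by deleting
    two disjoint edges that cover its neighbourhood.

    [delta <= 5]: suppose [delta >= 6], so that the graph is 3-connected.  By
    minimality each edge [uv] lies in every perfect matching of [G - Y], for
    some matched 4-set [Y].  Let [W] be the set of common neighbours of [u] and
    [v] outside [Y].  Each [w] in [W] cuts off an odd piece [B w] of [G - Y];
    after removing [W] and these pieces no triangle contains [uv], so removing
    [uv] keeps the graph claw-free and [uv] must be a bridge between two odd
    sides.  Hence [G - Y] consists of the core [{u, v} + W] and of pairwise
    non-adjacent petals [B t], [t] in the core, with all neighbours of [B t] in
    [Y + t]; a nonempty petal is a fragment, i.e. a set separated from a
    nonempty rest by at most five vertices.

    Let [O] be a smallest fragment, [X] its boundary and [R] the rest.  By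
    claw-freeness a vertex of [X] is adjacent to at most one, and any vertex to
    at most two, of pairwise non-adjacent parts of [R], while 3-connectivity
    gives every part at least three neighbours.  Counting these incidences for
    an edge inside [O] shows that petals do not meet [O] and then that [O] is a
    pair of twins [{u, v}].  The same count for an edge [ux], [x] in [X], with
    [x] having the fewest non-neighbours in [X], yields a contradiction. *)

Require Import Defs.
From mathcomp Require Import all_boot.
From mathcomp Require Import zify.

Set Implicit Arguments.
Unset Strict Implicit.
Unset Printing Implicit Defensive.

(** * Sumner's theorem *)

(** The obstacle is that deleting [uv] may create claws, though only at common neighbours of [u] and
    [v], so Sumner's theorem does not apply to the graph without [uv]. It does apply to the graph
    without [u] and [w], for a common neighbour [w]: a perfect matching there, completed by [uw],
    would avoid [uv]. The odd pieces [B w] come from this failure.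

    All the counts rest on one inequality. If pairwise non-adjacent parts of [R] have their
    boundaries in [X] and [Q], then three times their number is at most [#|X| + 2 * #|Q|]; a vertex
    of [X] counts once because its neighbour in [O] is already one leaf of a potential claw. Take
    [Q = R :&: Y]. A vertex of [Y] in [R] is no neighbour of a vertex of [O], and minimum degree six
    asks for a replacement; when that is a vertex of [W], it brings a petal of its own, which costs
    three incidences where the vertex of [Y] pays for two. The petals soon outnumber what the
    inequality allows. *)

Definition closed_in (T : finType) (r : rel T) (A C : {set T}) : bool :=
  (C \subset A) && [forall x in C, forall y in A, r x y ==> (y \in C)].

(** Closed sets are the unions of components, so Sumner's parity condition can be stated without
    speaking of components. *)
Definition all_even (T : finType) (r : rel T) (A : {set T}) : bool :=
  [forall C : {set T}, closed_in r A C ==> ~~ odd #|C|].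

(* A perfect matching of [A], given by its mate function. *)
Definition pm (T : finType) (r : rel T) (A : {set T}) : Prop :=
  exists m : T -> T, forall x, x \in A -> [/\ m x \in A, m (m x) = x & r x (m x)].

Definition clawless (T : finType) (r : rel T) (A : {set T}) : Prop :=
  forall x a b c, x \in A -> a \in A -> b \in A -> c \in A ->
    r x a -> r x b -> r x c -> a != b -> a != c -> b != c ->
    [|| r a b, r a c | r b c].

Section ClosedSets.
Variables (T : finType) (r : rel T).
Hypotheses (r_sym : symmetric r) (r_irr : irreflexive r).
Implicit Types A C D : {set T}.

Lemma odd_cardsD A C : odd #|A :\: C| = odd #|A| (+) odd #|A :&: C|.
Proof. by rewrite -(cardsID C A) oddD addbC addbA addbb. Qed.

Lemma odd_cardsDS A C : C \subset A -> odd #|A :\: C| = odd #|A| (+) odd #|C|.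
Proof. by move=> sCA; rewrite odd_cardsD (setIidPr sCA). Qed.

Lemma odd_cardsD2 A x y : x \in A -> y \in A -> x != y ->
  odd #|A :\: [set x; y]| = odd #|A|.
Proof.
move=> xA yA nxy; rewrite odd_cardsDS ?cards2 ?nxy ?addbF //.
by apply/subsetP => z /set2P[]->.
Qed.

Lemma closed_inP A C :
  reflect (C \subset A /\ forall x y, x \in C -> y \in A -> r x y -> y \in C)
          (closed_in r A C).
Proof.
apply: (iffP andP) => [[sCA /forall_inP H]|[sCA H]]; split=> //.
  by move=> x y xC yA rxy; move/forall_inP/(_ y yA)/implyP: (H x xC); apply.
by apply/forall_inP => x xC; apply/forall_inP => y yA; apply/implyP; apply: H.
Qed.

Lemma all_evenP A :
  reflect (forall C, closed_in r A C -> ~~ odd #|C|) (all_even r A).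
Proof.
apply: (iffP forallP) => H C; first by move/implyP: (H C).
by apply/implyP; apply: H.
Qed.

Lemma all_evenPn A :
  reflect (exists2 C, closed_in r A C & odd #|C|) (~~ all_even r A).
Proof.
apply: (iffP forallPn) => [[C]|[C cC oC]]; first by rewrite negb_imply negbK => /andP[]; exists C.
by exists C; rewrite negb_imply cC oC.
Qed.

Lemma closed_inC A C : closed_in r A C -> closed_in r A (A :\: C).
Proof.
move=> /closed_inP[sCA H]; apply/closed_inP; split; first exact: subsetDl.
move=> x y /setDP[xA xC] yA rxy; rewrite !inE yA andbT.
by apply: contra xC => yC; apply: H yC xA _; rewrite r_sym.
Qed.

Lemma closed_inI A C D :
  closed_in r A C -> closed_in r A D -> closed_in r A (C :&: D).
Proof.
move=> /closed_inP[sCA HC] /closed_inP[sDA HD]; apply/closed_inP; split.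
  by apply: subset_trans sCA; apply: subsetIl.
by move=> x y /setIP[xC xD] yA rxy; rewrite inE (HC x) // (HD x).
Qed.

Lemma closed_inD A C D :
  closed_in r A C -> closed_in r A D -> closed_in r A (C :\: D).
Proof.
move=> cC /closed_inC cD.
have -> : C :\: D = C :&: (A :\: D); last exact: closed_inI.
apply/setP => z; rewrite !inE; case: (boolP (z \in C)) => zC; rewrite ?andbF //=.
by case/closed_inP: cC => /subsetP/(_ z zC) -> _; rewrite andbT.
Qed.

Lemma closed_in_refl A : closed_in r A A.
Proof. by apply/closed_inP. Qed.

Lemma pm_all_even A : pm r A -> all_even r A.
Proof.
case=> m Hm; apply/all_evenP => C /closed_inP[/subsetP sCA HC].
have inv x : x \in C -> [/\ m x \in C, m (m x) = x & m x != x].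
  move=> xC; have [mA mm rm] := Hm x (sCA x xC); split=> //.
    exact: HC xC mA rm.
  by apply: contraTneq rm => ->; rewrite r_irr.
have [n] := ubnP #|C|.
elim: n C inv {sCA HC} => // n IHn C inv /ltnSE leC.
have [->|[x xC]] := set_0Vmem C; first by rewrite cards0.
have [mC mm mx] := inv x xC.
have cC : #|C| = (#|C :\: [set x; m x]|).+2.
  rewrite -(cardsID [set x; m x] C) (setIidPr _) ?cards2 1?[x == _]eq_sym ?mx //.
  by apply/subsetP => z /set2P[]->.
rewrite cC /= negbK; apply: IHn; last by rewrite cC in leC; lia.
move=> y; rewrite !inE negb_or -andbA => /and3P[yx ymx yC].
have [? my ?] := inv y yC; split=> //; rewrite negb_or -andbA; apply/and3P; split=> //.
  by apply: contraNneq ymx => <-; rewrite my.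
by apply: contraNneq yx => e; rewrite -my e mm.
Qed.

Lemma pm_add A x y : x \in A -> y \in A -> r x y -> pm r (A :\: [set x; y]) -> pm r A.
Proof.
move=> xA yA rxy [m Hm].
have nxy : x != y by apply: contraTneq rxy => ->; rewrite r_irr.
exists (fun z => if z == x then y else if z == y then x else m z) => z zA.
have [->|zx] := eqVneq z x; first by rewrite eq_sym (negPf nxy) eqxx.
have [->|zy] := eqVneq z y; first by rewrite eqxx r_sym.
have /Hm[] : z \in A :\: [set x; y] by rewrite !inE negb_or zx zy zA.
by rewrite !inE negb_or -andbA => /and3P[/negPf-> /negPf-> ->].
Qed.

Lemma clawlessS A C : C \subset A -> clawless r A -> clawless r C.
Proof.
by move=> /subsetP s H x a b c xC aC bC cC; apply: H; apply: s.
Qed.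

(* Otherwise take an odd closed set [C] of [A - {x, y}], over all edges [xy],
   of smallest size.  For [c] in [C] adjacent to [x], the edge [xc] leaves an
   odd closed set that avoids [C] and [y] and touches only [x]; a claw at [x]
   then forces [c ~ y], so the same happens at [y], and the remaining odd piece
   yields a claw at [x] or at [y]. *)
Lemma even_removable_edge A : clawless r A -> all_even r A -> A != set0 ->
  exists x y, [/\ x \in A, y \in A, r x y & all_even r (A :\: [set x; y])].
Proof.
move=> claw ev A0.
have evA := all_evenP _ ev.
pose bad (p : T * T * {set T}) := [&& p.1.1 \in A, p.1.2 \in A, r p.1.1 p.1.2,
   closed_in r (A :\: [set p.1.1; p.1.2]) p.2 & odd #|p.2|].
case: (boolP [exists x in A, exists y in A, r x y && all_even r (A :\: [set x; y])]).
  by case/exists_inP=> x xA /exists_inP[y yA /andP[rxy H]]; exists x, y.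
move=> nex; exfalso.
have no_edge x y : x \in A -> y \in A -> r x y ->
    exists C, bad (x, y, C).
  move=> xA yA rxy; suff /all_evenPn[C cC oC] : ~~ all_even r (A :\: [set x; y]).
    by exists C; rewrite /bad /= xA yA rxy cC oC.
  apply: contra nex => H; apply/exists_inP; exists x => //.
  by apply/exists_inP; exists y => //; rewrite rxy H.
have [p0 bp0] : exists p, bad p.
  case/set0Pn: A0 => x xA; suff [y yA rxy] : exists2 y, y \in A & r x y.
    by have [C] := no_edge x y xA yA rxy; exists (x, y, C).
  apply/exists_inP; apply: contraT => /exists_inPn H.
  have := evA [set x]; rewrite cards1; apply.
  apply/closed_inP; split; first by rewrite sub1set.
  by move=> z y /set1P -> yA rxy; have := H y yA; rewrite rxy.
case: (@arg_minnP _ p0 bad (fun p => #|p.2|) bp0) => -[[x y] C].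
rewrite /bad /= => /and5P[xA yA rxy cC oC] Cmin.
have {}Cmin x' y' C' : x' \in A -> y' \in A -> r x' y' ->
    closed_in r (A :\: [set x'; y']) C' -> odd #|C'| -> #|C| <= #|C'|.
  by move=> *; apply: (Cmin (x', y', C')); apply/and5P; split.
clear p0 bp0 nex.
have nyx : y != x by apply: contraTneq rxy => ->; rewrite r_irr.
have step a b : [set a; b] = [set x; y] -> a \in A -> b \in A -> r a b -> a != b ->
  forall c, c \in C -> r a c -> r b c /\
   exists E : {set T}, [/\ odd #|E|, E \subset A :\: [set x; y] :\: C,
     closed_in r (A :\: [set x; y]) E, (forall z, z \in E -> ~~ r z b) & exists2 z, z \in E & r a z].
  move=> eab aA bA rab nab c cC' rac.
  case/closed_inP: (cC) => /subsetP sC HC.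
  have /setDP[cA cab] := sC _ cC'; rewrite -eab !inE negb_or in cab.
  case/andP: cab => nca ncb.
  have [D /and5P[/= _ _ _ cD oD]] := no_edge a c aA cA rac.
  have oAac : ~~ odd #|A :\: [set a; c]|.
    by rewrite odd_cardsD2 1?eq_sym //; apply: evA; apply: closed_in_refl.
  (* [A :\: [set a; c]] is even, so the complement of [D] in it is again odd and closed; one of the
     two misses [b]. *)
  wlog bD : D cD oD / b \notin D.
    move=> W; case: (boolP (b \in D)) => bD; last exact: W bD.
    apply: (W (A :\: [set a; c] :\: D)); [exact: closed_inC| |by rewrite !inE bD].
    by rewrite odd_cardsDS ?(negPf oAac) ?oD //; case/closed_inP: cD.
  case/closed_inP: (cD) => /subsetP sD HD.
  have sDA z : z \in D -> [/\ z \in A, z != a, z != c & z != b].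
    move=> zD; have := sD z zD; rewrite !inE negb_or -andbA => /and3P[-> -> ->]; split=> //.
    by apply: contraNneq bD => <-.
  have cI : closed_in r (A :\: [set a; c]) (D :&: C).
    apply/closed_inP; split; first by apply/subsetP => z /setIP[/sD].
    move=> z t /setIP[zD zC] tA rzt; have tD := HD z t zD tA rzt; rewrite inE tD.
    by apply: HC zC _ rzt; rewrite -eab !inE negb_or; have [-> -> _ ->] := sDA t tD.
  (* This set is closed after removal of [a] and [c], and it misses [c]; if odd, it would contradict
     the minimality of [C]. *)
  have eI : ~~ odd #|D :&: C|.
    apply/negP => oI; have := Cmin a c _ aA cA rac cI oI.
    rewrite leqNgt => /negP; apply; apply: proper_card; apply/properP; split; first exact: subsetIr.
    exists c => //; rewrite inE cC' andbT; apply/negP => cD'.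
    by have [_ _ /eqP] := sDA c cD'.
  pose E := D :\: C.
  have oE : odd #|E| by rewrite odd_cardsD oD (negPf eI).
  have sE : E \subset A :\: [set x; y] :\: C.
    apply/subsetP => z /setDP[zD zC]; rewrite -eab !inE zC negb_or.
    by have [-> -> _ ->] := sDA z zD.
  have HE z t : z \in E -> t \in A -> r z t -> t \in E \/ t = a.
    move=> /setDP[zD zC] tA rzt; have [|nta] := eqVneq t a; [by right|left].
    have tC : t \notin C.
      apply: contra zC => tC; apply: HC tC _ _; last by rewrite r_sym.
      by rewrite -eab !inE negb_or; have [-> -> _ ->] := sDA z zD.
    rewrite inE tC; apply: HD zD _ rzt; rewrite !inE negb_or nta tA andbT /=.
    by apply: contraNneq tC => ->.
  have Eb z : z \in E -> ~~ r z b.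
    move=> zE; apply/negP => rzb; case: (HE z b zE bA rzb) => [|e].
      by rewrite inE (negPf bD) andbF.
    by rewrite e eqxx in nab.
  have [z zE raz] : exists2 z, z \in E & r a z.
    apply/exists_inP; apply: contraT => /exists_inPn H.
    suff /evA : closed_in r A E by rewrite oE.
    apply/closed_inP; split; first by apply/subsetP => z /setDP[/sDA[]].
    by move=> z t zE tA rzt; case: (HE z t zE tA rzt) => // e; have := H z zE; rewrite -e r_sym rzt.
  have /setDP[zD zC] := zE.
  have [zA nza nzc nzb] := sDA z zD.
  split.
    have := claw a z b c aA zA bA cA raz rab rac nzb nzc; rewrite eq_sym ncb => /(_ isT).
    rewrite (negPf (Eb z zE)) /=; case/orP=> // rzc.
    by case: (HE z c zE cA rzc) => [/setDP[_]|/eqP]; [rewrite cC'|rewrite (negPf nca)].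
  exists E; split=> //; last by exists z.
  apply/closed_inP; split; first by apply: subset_trans sE _; apply: subsetDl.
  move=> z' t zE' /setDP[tA]; rewrite -eab !inE negb_or => /andP[nta ntb] rzt.
  by case: (HE z' t zE' tA rzt) => [/setDP[-> ->]//|e]; rewrite e eqxx in nta.
have rxyC : exists2 c, c \in C & r x c || r y c.
  apply/exists_inP; apply: contraT => /exists_inPn H.
  suff /evA : closed_in r A C by rewrite oC.
  case/closed_inP: cC => /subsetP sC HC; apply/closed_inP; split.
    by apply/subsetP => z /sC /setDP[].
  move=> z t zC tA rzt; have := H z zC; rewrite negb_or => /andP[nx ny].
  apply: HC zC _ (rzt); rewrite !inE tA andbT negb_or.
  by apply/andP; split; apply: contraTneq rzt => ->; rewrite r_sym.
have ryx : r y x by rewrite r_sym.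
have [c cC' [rxc ryc]] : exists2 c, c \in C & r x c /\ r y c.
  case: rxyC => c cC' /orP[rc|rc]; exists c => //.
    by have [] := step x y erefl xA yA rxy _ c cC' rc; first by rewrite eq_sym.
  by have [] := step y x (setUC _ _) yA xA ryx nyx c cC' rc.
have [|_ [E [oE sE cE Ey [z zE rxz]]]] := step x y erefl xA yA rxy _ c cC' rxc; first by rewrite eq_sym.
have [_ [F [oF sF cF Fx [t tF ryt]]]] := step y x (setUC _ _) yA xA ryx nyx c cC' ryc.
pose G := A :\: [set x; y] :\: C :\: E :\: F.
have cG : closed_in r (A :\: [set x; y]) G.
  by do 3 (apply: closed_inD => //); apply: closed_in_refl.
have oEF : ~~ odd #|E :&: F|.
  apply: evA; have /closed_inP[/subsetP sEF HEF] := closed_inI cE cF.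
  apply/closed_inP; split=> [|z' w' zEF wA rzw].
    by apply/subsetP => z' /sEF /setDP[].
  case/setIP: (zEF) => zE' zF'; apply: (HEF z') => //.
  rewrite !inE wA andbT negb_or; apply/andP; split; apply: contraTneq rzw => ->.
    exact: Fx.
  exact: Ey.
have sCA : C \subset A :\: [set x; y] by case/closed_inP: cC.
(* The even set [A :\: [set x; y]] loses the odd sets [C], [E] and [F :\: E]; the last is odd
   because [E :&: F] is closed in [A], hence even. *)
have oG : odd #|G|.
  rewrite /G odd_cardsD odd_cardsDS // odd_cardsDS // odd_cardsD2 1?eq_sym // oC oE.
  have -> : (A :\: [set x; y] :\: C :\: E) :&: F = F :\: E.
    apply/setP => w'; rewrite 2!inE [in RHS]inE; apply/andP/andP => -[h1 h2]; split=> //.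
      by case/andP: h1.
    by rewrite h1; apply: subsetP sF _ h2.
  by rewrite odd_cardsD oF setIC (negPf oEF) (negPf (evA A (closed_in_refl A))).
have [g gG rg] : exists2 g, g \in G & r x g || r y g.
  apply/exists_inP; apply: contraT => /exists_inPn H.
  suff /evA : closed_in r A G by rewrite oG.
  case/closed_inP: cG => /subsetP sG HG; apply/closed_inP; split.
    by apply/subsetP => w' /sG /setDP[].
  move=> w' t' wG tA rwt; have := H w' wG; rewrite negb_or => /andP[nx ny].
  apply: HG wG _ (rwt); rewrite !inE tA andbT negb_or.
  by apply/andP; split; apply: contraTneq rwt => ->; rewrite r_sym.
have sep C1 z1 z2 : closed_in r (A :\: [set x; y]) C1 -> z1 \in C1 ->
    z2 \in A :\: [set x; y] -> z2 \notin C1 -> (r z1 z2 = false) /\ z1 != z2.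
  move=> /closed_inP[_ H] z1C z2A z2C; split; last by apply: contraNneq z2C => <-.
  by apply: contraNF z2C; apply: H.
have [[[gxy gC] gE] gF] : [/\ [/\ g \in A :\: [set x; y] & g \notin C] , g \notin E & g \notin F].
  by move: gG; rewrite /G => /setDP[/setDP[/setDP[-> ->] ->] ->].
have claw3 a E1 e1 : a \in A -> closed_in r (A :\: [set x; y]) E1 -> e1 \in E1 -> g \notin E1 ->
    E1 \subset A :\: [set x; y] :\: C -> r a e1 -> r a c -> r a g -> False.
  move=> aA cE1 e1E gE1 sE1 re1 rc rg'.
  have /setDP[e1A e1C] := subsetP sE1 _ e1E.
  have cA := subsetP sCA _ cC'.
  have [r1 n1] := sep _ _ _ cE1 e1E gxy gE1.
  have [r2 n2] := sep _ _ _ cC cC' gxy gC.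
  have [r3 n3] := sep _ _ _ cC cC' e1A e1C.
  have inA w' : w' \in A :\: [set x; y] -> w' \in A by case/setDP.
  have := claw a c e1 g aA (inA _ cA) (inA _ e1A) (inA _ gxy) rc re1 rg' n3 n2 n1.
  by rewrite r1 r2 r3.
by case/orP: rg => rg; [apply: (claw3 x E z)|apply: (claw3 y F t)].
Qed.

Lemma sumner A : clawless r A -> all_even r A -> pm r A.
Proof.
have [n] := ubnP #|A|; elim: n A => // n IHn A /ltnSE leA claw ev.
have [->|A0] := eqVneq A set0; first by exists id => x; rewrite inE.
have [x [y [xA yA rxy evxy]]] := even_removable_edge claw ev A0.
apply: (pm_add xA yA rxy); apply: IHn => //; last by apply: clawlessS claw; apply: subsetDl.
apply: leq_trans leA; apply: proper_card; apply/properP; split; first exact: subsetDl.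
by exists x => //; rewrite !inE eqxx.
Qed.
End ClosedSets.

(** * Matchings as mate functions *)

Section Interface.
Variables (T : finType) (r : rel T).
Hypotheses (r_sym : symmetric r) (r_irr : irreflexive r).

Lemma rel_neq x y : r x y -> x != y.
Proof. by apply: contraTneq => ->; rewrite r_irr. Qed.

Lemma set2_inj (x y z : T) : x != y -> [set x; y] = [set x; z] -> y = z.
Proof.
move=> nxy E; have : y \in [set x; z] by rewrite -E !inE eqxx orbT.
by rewrite !inE eq_sym (negPf nxy) => /eqP.
Qed.

Lemma edgesP (A : {set T}) :
  reflect (exists x y, r x y /\ A = [set x; y]) (A \in edges r).
Proof.
apply: (iffP imsetP) => [[[x y]]|[x [y [rxy ->]]]].
  by rewrite inE => /= rxy ->; exists x, y.
by exists (x, y); rewrite ?inE.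
Qed.

Lemma perfect_matching_mate (N : {set {set T}}) : perfect_matching r N ->
  exists m : T -> T, forall x, [/\ r x (m x), m (m x) = x & [set x; m x] \in N].
Proof.
case/andP=> /andP[/subsetP sN /trivIsetP tN] /eqP cN.
have ex x : exists y, r x y && ([set x; y] \in N).
  have : x \in cover N by rewrite cN inE.
  case/bigcupP=> A AN xA; case/edgesP: (sN A AN) => a [b [rab eA]].
  move: xA AN; rewrite eA => /set2P[->|->] AN; first by exists b; rewrite rab.
  by exists a; rewrite r_sym rab setUC.
have uniqN x y z : r x y -> [set x; y] \in N -> [set x; z] \in N -> y = z.
  move=> rxy yN zN; apply: (set2_inj (rel_neq rxy)); apply/eqP.
  apply: contraT => /(tN _ _ yN zN)/disjointFr/(_ (set21 x y)).
  by rewrite !inE eqxx.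
have [m Hm] := fin_all_exists ex.
exists m => x; have /andP[rx Nx] := Hm x; have /andP[rx' Nx'] := Hm (m x).
by split=> //; apply: uniqN rx' Nx' _; rewrite setUC.
Qed.

Lemma mate_perfect_matching (m : T -> T) :
  (forall x, r x (m x) /\ m (m x) = x) ->
  perfect_matching r [set [set x; m x] | x in T].
Proof.
move=> Hm; apply/andP; split; last first.
  apply/eqP/setP => x; rewrite inE; apply/bigcupP; exists [set x; m x].
    exact: imset_f.
  by rewrite set21.
apply/andP; split.
  apply/subsetP => _ /imsetP[x _ ->]; apply/edgesP; exists x, (m x).
  by have [] := Hm x.
apply/trivIsetP => _ _ /imsetP[x _ ->] /imsetP[y _ ->].
apply: contraR => /pred0Pn[z /andP[/= /set2P zx /set2P zy]].
have E w : z = w \/ z = m w -> [set w; m w] = [set z; m z].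
  by case=> -> //; rewrite (Hm w).2 setUC.
by rewrite (E x) // (E y).
Qed.

Lemma cover2_uniq a b c d : r a b -> r c d ->
  [disjoint [set a; b] & [set c; d]] = uniq [:: a; b; c; d].
Proof.
move=> rab rcd; have nab := rel_neq rab; have ncd := rel_neq rcd.
rewrite /= !inE (negPf nab) (negPf ncd) /= !andbT negb_or.
apply/idP/idP => [D|].
  have inD z : z \in [set a; b] -> z \notin [set c; d].
    by move=> zD; rewrite (disjointFr D zD).
  by have := inD a (set21 _ _); have := inD b (set22 _ _); rewrite !inE !negb_or => -> ->.
case/andP=> /andP[ac ad] /norP[bc bd]; apply/pred0Pn => -[z /andP[/= ]].
by case/set2P=> ->; rewrite !inE ?(negPf ac) ?(negPf ad) ?(negPf bc) ?(negPf bd).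
Qed.

Lemma extendable2_pm : extendable r 2 -> pm r [set: T] /\
  forall a b c d, r a b -> r c d -> uniq [:: a; b; c; d] -> pm r (~: [set a; b; c; d]).
Proof.
case/and5P=> _ _ _ /existsP[M pM] /forallP ext; split.
  have [m Hm] := perfect_matching_mate pM; exists m => x _.
  by have [? ? _] := Hm x; rewrite inE.
move=> a b c d rab rcd U.
have D : [disjoint [set a; b] & [set c; d]] by rewrite cover2_uniq.
have ne : [set a; b] != [set c; d].
  apply: contraTneq D => ->; rewrite disjoints_subset; apply/negP => /subsetP/(_ c).
  by rewrite !inE eqxx => /(_ isT).
have /existsP[N /andP[pN sN]] : [exists N : {set {set T}},
    perfect_matching r N && ([set [set a; b]; [set c; d]] \subset N)].
  apply: (implyP (ext [set [set a; b]; [set c; d]])).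
  rewrite cards2 ne eqxx andbT; apply/andP; split.
    by apply/subsetP => A /set2P[]->; apply/edgesP; [exists a, b|exists c, d].
  apply/trivIsetP => A B /set2P[]-> /set2P[]->; rewrite ?eqxx // => _.
  by rewrite disjoint_sym.
have [m Hm] := perfect_matching_mate pN.
have mE x y : r x y -> [set x; y] \in N -> m x = y /\ m y = x.
  move=> rxy yN; have [rm mm mN] := Hm x.
  suff -> : y = m x by [].
  apply: (set2_inj (rel_neq rxy)); apply/eqP; apply: contraT => ne'.
  have /andP[/andP[_ /trivIsetP tN] _] := pN.
  have /disjointFr/(_ (set21 x y)) := tN _ _ yN mN ne'.
  by rewrite !inE eqxx.
have [mab mba] : m a = b /\ m b = a by apply: mE => //; rewrite (subsetP sN) ?set21.
have [mcd mdc] : m c = d /\ m d = c by apply: mE => //; rewrite (subsetP sN) ?set22.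
exists m => x; rewrite !inE !negb_or -!andbA => /and4P[xa xb xc xd].
have [rx mm _] := Hm x; split=> //.
by apply/and4P; split; apply: contraNneq xa => E; move: xb xc xd; rewrite -mm E ?mab ?mba ?mcd ?mdc ?eqxx.
Qed.

Lemma extendable2_intro : 6 <= #|T| -> connected r -> pm r [set: T] ->
  (forall a b c d, r a b -> r c d -> uniq [:: a; b; c; d] -> pm r (~: [set a; b; c; d])) ->
  extendable r 2.
Proof.
move=> T6 con [m0 Hm0] ext; apply/and5P; split=> //.
  apply/existsP; exists [set [set x; m0 x] | x in T].
  by apply: mate_perfect_matching => x; have [] := Hm0 x (in_setT x).
apply/forallP => M; apply/implyP => /andP[/andP[/subsetP sM /trivIsetP tM]].
case/cards2P=> A [B [nAB eM]].
have AM : A \in M by rewrite eM set21.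
have BM : B \in M by rewrite eM set22.
have /edgesP[a [b [rab eA]]] := sM _ AM.
have /edgesP[c [d [rcd eB]]] := sM _ BM.
have U : uniq [:: a; b; c; d].
  by rewrite -cover2_uniq // -eA -eB; apply: tM.
have [m Hm] := ext a b c d rab rcd U.
pose m' x := if x == a then b else if x == b then a else if x == c then d
             else if x == d then c else m x.
move: (U); rewrite /= !inE !negb_or !andbT -!andbA => /and5P[ab ac ad bc /andP[bd cd]].
have m'a : m' a = b by rewrite /m' eqxx.
have m'b : m' b = a by rewrite /m' eq_sym (negPf ab) eqxx.
have m'c : m' c = d by rewrite /m' ![c == _]eq_sym (negPf ac) (negPf bc) eqxx.
have m'd : m' d = c by rewrite /m' ![d == _]eq_sym (negPf ad) (negPf bd) (negPf cd) eqxx.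
have Hm' x : r x (m' x) /\ m' (m' x) = x.
  have [->|xa] := eqVneq x a; first by rewrite m'a m'b.
  have [->|xb] := eqVneq x b; first by rewrite m'b m'a r_sym.
  have [->|xc] := eqVneq x c; first by rewrite m'c m'd.
  have [->|xd] := eqVneq x d; first by rewrite m'd m'c r_sym.
  have [|mA mm rm] := Hm x; first by rewrite !inE (negPf xa) (negPf xb) (negPf xc).
  have -> : m' x = m x by rewrite /m' (negPf xa) (negPf xb) (negPf xc) (negPf xd).
  split=> //; move: mA; rewrite !inE !negb_or -!andbA => /and4P[ya yb yc yd].
  by rewrite /m' (negPf ya) (negPf yb) (negPf yc) (negPf yd).
apply/existsP; exists [set [set x; m' x] | x in T].
rewrite mate_perfect_matching //=; apply/subsetP => D; rewrite eM => /set2P[]->.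
  by rewrite eA; apply/imsetP; exists a; rewrite ?m'a.
by rewrite eB; apply/imsetP; exists c; rewrite ?m'c.
Qed.

(** The bound on [#|T|] takes care of the default value of the iterated minimum. *)
Lemma min_degree_ge k : k <= #|T| -> (forall x, k <= degree r x) -> k <= min_degree r.
Proof.
move=> kT kd; rewrite /min_degree; elim/big_ind: _ => // a b; rewrite leq_min => -> //.
Qed.

Lemma min_degree_le x : min_degree r <= degree r x.
Proof.
rewrite /min_degree; have := mem_index_enum x; elim: (index_enum T) => // y s IHs.
rewrite inE big_cons geq_min => /orP[/eqP->|/IHs->]; first by rewrite leqnn.
exact: orbT.
Qed.

Lemma claw_free_clawless : claw_free r -> clawless r [set: T].
Proof.
move=> cf x a b c _ _ _ _ xa xb xc ab ac bc; apply: contraT.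
rewrite !negb_or => /and3P[nab nac nbc]; case: cf.
pose g (i : 'I_3) := nth x [:: a; b; c] i.
exists (fun s : ('I_1 + 'I_3)%type => match s with inl _ => x | inr i => g i end).
  have xg i : x != g i by case: i => -[|[|[|]]] //= ?; apply: rel_neq.
  case=> [i|i] [j|j]; rewrite ?(ord1 i) ?(ord1 j) // => /eqP.
  - by rewrite (negPf (xg j)).
  - by rewrite eq_sym (negPf (xg i)).
  have U : uniq [:: a; b; c] by rewrite /= !inE negb_or ab ac bc.
  by rewrite /g nth_uniq // => /eqP E; congr inr; apply: val_inj.
have rg i : r x (g i) by case: i => -[|[|[|]]].
have gg i j : r (g i) (g j) = false.
  case: i j => -[|[|[|i]]] //= ? [[|[|[|j]]] //= ?]; rewrite /g /= ?r_irr //; apply/negbTE => //; by rewrite r_sym.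
by case=> [i|i] [j|j] /=; rewrite ?r_irr ?rg ?gg // r_sym rg.
Qed.
End Interface.

(** * Deleting one edge *)

Section DelEdge.
Variables (T : finType) (e : rel T).
Hypotheses (e_sym : symmetric e) (e_irr : irreflexive e).

Lemma set2_eq (x y u v : T) : ([set x; y] == [set u; v]) =
  (x == u) && (y == v) || (x == v) && (y == u).
Proof.
apply/eqP/idP => [E|/orP[]/andP[/eqP-> /eqP->] //]; last by rewrite setUC.
have : [&& x \in [set u; v], y \in [set u; v], u \in [set x; y] & v \in [set x; y]].
  by rewrite -E {3 4}E !inE !eqxx !orbT.
rewrite !inE ![u == _]eq_sym ![v == _]eq_sym.
by case: (x == u); case: (x == v); case: (y == u); case: (y == v).
Qed.

Lemma del_edgeE (u v x y : T) : del_edge e [set u; v] x y =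
  e x y && ~~ ((x == u) && (y == v) || (x == v) && (y == u)).
Proof. by rewrite -set2_eq. Qed.

Lemma del_edge_sym f : symmetric (del_edge e f).
Proof. by move=> x y; rewrite /del_edge /= e_sym setUC. Qed.

Lemma del_edge_irr f : irreflexive (del_edge e f).
Proof. by move=> x; rewrite /del_edge /= e_irr. Qed.

End DelEdge.

(** * Edges contained in every perfect matching *)

(** [B t] is the part of [H] attached to the core at [t]; [B] is total on [T], but only its values
    on the core carry information. Parity makes the petals at [W] nonempty, whereas those at [u] and
    [v] may be empty. *)
Record petals (T : finType) (e : rel T) (H : {set T}) (u v : T) (W : {set T})
    (B : T -> {set T}) : Prop := Petals {
  petals_centre : forall w, w \in W -> [/\ w \in H, e u w & e v w];
  petals_cover : forall z, z \in H ->
    z \in [set u; v] :|: W \/ exists2 t, t \in [set u; v] :|: W & z \in B t;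
  petals_sub : forall t z, t \in [set u; v] :|: W -> z \in B t ->
    z \in H /\ z \notin [set u; v] :|: W;
  petals_nb : forall t z y, t \in [set u; v] :|: W -> z \in B t -> y \in H ->
    e z y -> y \in B t \/ y = t;
  petals_disj : forall t t' z, t \in [set u; v] :|: W -> t' \in [set u; v] :|: W ->
    z \in B t -> z \in B t' -> t = t';
  petals_odd : forall w, w \in W -> odd #|B w|;
  petals_touch : forall w, w \in W -> exists2 z, z \in B w & e w z;
  petals_even : forall t, t \in [set u; v] -> ~~ odd #|B t|
}.

Section Forced.
Variables (T : finType) (e : rel T).
Hypotheses (e_sym : symmetric e) (e_irr : irreflexive e).
Hypothesis claw : clawless e [set: T].

Lemma no_claw x a b c : e x a -> e x b -> e x c -> a != b -> a != c -> b != c ->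
  ~~ e a b -> ~~ e a c -> ~~ e b c -> False.
Proof.
move=> xa xb xc ab ac bc /negPf nab /negPf nac /negPf nbc.
have := claw (in_setT x) (in_setT a) (in_setT b) (in_setT c) xa xb xc ab ac bc.
by rewrite nab nac nbc.
Qed.

Lemma clawlessT A : clawless e A.
Proof. by apply: clawlessS claw; apply: subsetT. Qed.

Lemma pm_sub_rel (r r' : rel T) (A : {set T}) :
  (forall x y, x \in A -> y \in A -> r x y -> r' x y) -> pm r A -> pm r' A.
Proof. by move=> H [m Hm]; exists m => x xA; have [? ? ?] := Hm x xA; split=> //; apply: H. Qed.

(** A perfect matching of [H - {u, w}] together with [uw] would be one of [H] without [uv], so
    Sumner's theorem yields an odd closed set. As [H - {u, w}] is even, its complement is odd too,
    and one of the two misses [v]. *)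
Lemma forced_odd (H : {set T}) u v w : u \in H -> w \in H -> v \in H -> v != w ->
  e u v -> e u w -> all_even e H -> ~ pm (del_edge e [set u; v]) H ->
  exists C, [/\ closed_in e (H :\: [set u; w]) C, odd #|C| & v \notin C].
Proof.
move=> uH wH vH vw euv euw evH npm.
have nuw := rel_neq e_irr euw.
have /all_evenPn[C cC oC] : ~~ all_even e (H :\: [set u; w]).
  apply/negP => /(sumner e_sym e_irr (clawlessT (A := _))) pmA; apply: npm.
  apply: (pm_add (del_edge_sym e_sym _) (del_edge_irr e_irr _) uH wH).
    by rewrite del_edgeE euw eqxx (eq_sym w) (negPf vw) (eq_sym w) (negPf nuw) !andbF.
  apply: pm_sub_rel pmA => x y; rewrite !inE !negb_or -!andbA => /and3P[xu _ _] /and3P[yu _ _] exy.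
  by rewrite del_edgeE exy (negPf xu) (negPf yu) andbF.
have [vC|] := boolP (v \in C); last by exists C.
exists (H :\: [set u; w] :\: C); split; first exact: closed_inC.
  rewrite odd_cardsDS; last by case/closed_inP: cC.
  by rewrite odd_cardsD2 // oC (negPf (all_evenP _ _ evH H (closed_in_refl _ _))).
by rewrite inE vC.
Qed.

Variables (H : {set T}) (u v : T).
Hypotheses (uH : u \in H) (vH : v \in H) (euv : e u v) (pmH : pm e H).
Hypothesis (npm : ~ pm (del_edge e [set u; v]) H).

Let evH : all_even e H := pm_all_even e_irr pmH.
Let nuv : u != v := rel_neq e_irr euv.

(** Any perfect matching of [H] contains [uv]; dropping that edge leaves a perfect matching of the
    rest. *)
Lemma forced_core_even : all_even e (H :\: [set u; v]).
Proof.
apply: (pm_all_even e_irr); case: pmH => m Hm.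
have [muv|muv] := eqVneq (m u) v; last first.
  case: npm; exists m => x xH; have [mH mm em] := Hm x xH; split=> //.
  rewrite del_edgeE em; apply/negP => /orP[]/andP[/eqP E1 /eqP E2].
    by rewrite -E1 E2 eqxx in muv.
  by rewrite -E2 mm E1 eqxx in muv.
have mvu : m v = u by rewrite -muv; have [] := Hm u uH.
exists m => x; rewrite !inE !negb_or -!andbA => /and3P[xu xv xH].
have [mH mm em] := Hm x xH; split=> //; rewrite mH andbT.
apply/andP; split; [apply: contraNneq xv|apply: contraNneq xu] => E.
  by rewrite -mm E muv.
by rewrite -mm E mvu.
Qed.

Definition pendant w (C : {set T}) :=
  [&& C \subset H :\: [set u; v] :\ w, odd #|C| &
    [forall z in C, forall y in H, e z y ==> (y \in C) || (y == w)]].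

Lemma pendantP w (C : {set T}) : reflect
  [/\ forall z, z \in C -> [/\ z \in H, z != u, z != v & z != w], odd #|C| &
    forall z y, z \in C -> y \in H -> e z y -> y \in C \/ y = w] (pendant w C).
Proof.
apply: (iffP and3P) => [[/subsetP sC oC /forall_inP nC]|[sC oC nC]]; split=> //.
- by move=> z /sC; rewrite !inE negb_or -!andbA => /and4P[].
- by move=> z y zC yH ezy; have := implyP (forall_inP (nC z zC) y yH) ezy => /orP[|/eqP]; [left|right].
- by apply/subsetP => z /sC[? ? ? ?]; rewrite !inE negb_or; apply/and3P; split=> //; apply/andP.
apply/forall_inP => z zC; apply/forall_inP => y yH; apply/implyP => ezy.
by case: (nC z y zC yH ezy) => ->; rewrite ?eqxx ?orbT.
Qed.

(** [B] comes from the edge [uw] and [B'] from [vw]. If their intersection is odd, it is pendant.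
    Otherwise [B - B'], [B' - B] and the remainder of [H - {u, v, w}] are all odd; each touches [w]
    because [H - {u, v}] has only even unions of components, and this gives a claw at [w]. *)
Lemma pendant_ex w : w \in H -> e u w -> e v w -> exists C, pendant w C.
Proof.
move=> wH euw evw.
have nuw := rel_neq e_irr euw; have nvw := rel_neq e_irr evw.
have [B [cB oB vB]] := forced_odd uH wH vH nvw euv euw evH npm.
have npm' : ~ pm (del_edge e [set v; u]) H by rewrite setUC.
have evu : e v u by rewrite e_sym.
have [B' [cB' oB' uB']] := forced_odd vH wH uH nuw evu evw evH npm'.
have evK := all_evenP _ _ forced_core_even.
have [/subsetP sB HB] := closed_inP _ _ _ cB.
have [/subsetP sB' HB'] := closed_inP _ _ _ cB'.
have inB z : z \in B -> [/\ z \in H, z != u, z != v & z != w].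
  move=> zB; have := sB z zB; rewrite !inE negb_or -andbA => /and3P[-> -> ->]; split=> //.
  by apply: contraNneq vB => <-.
have inB' z : z \in B' -> [/\ z \in H, z != u, z != v & z != w].
  move=> zB; have := sB' z zB; rewrite !inE negb_or -andbA => /and3P[-> -> ->]; split=> //.
  by apply: contraNneq uB' => <-.
have nB z y : z \in B -> y \in H -> e z y -> [\/ y \in B, y = u | y = w].
  move=> zB yH ezy; have [|yu] := eqVneq y u; first by constructor 2.
  have [|yw] := eqVneq y w; first by constructor 3.
  by constructor 1; apply: HB zB _ ezy; rewrite !inE negb_or yu yw.
have nB' z y : z \in B' -> y \in H -> e z y -> [\/ y \in B', y = v | y = w].
  move=> zB yH ezy; have [|yv] := eqVneq y v; first by constructor 2.
  have [|yw] := eqVneq y w; first by constructor 3.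
  by constructor 1; apply: HB' zB _ ezy; rewrite !inE negb_or yv yw.
have [oI|eI] := boolP (odd #|B :&: B'|).
  exists (B :&: B'); apply/pendantP; split=> // [z /setIP[/inB]//|z y /setIP[zB zB'] yH ezy].
  case: (nB z y zB yH ezy) (nB' z y zB' yH ezy) => [yB|yu|]; last by right.
    case=> [yB'|yv|]; [by left; rewrite inE yB|by rewrite -yv yB in vB|by right].
  by case=> [yB'|yv|]; [rewrite -yu yB' in uB'|move: nuv; rewrite -yu -yv eqxx|right].
exfalso.
pose K := H :\: [set u; v] :\ w.
have inK z : z \in K = [&& z != w, z != u, z != v & z \in H].
  by rewrite !inE negb_or -!andbA.
have cK (D : {set T}) : (forall z, z \in D -> [/\ z \in H, z != u, z != v & z != w]) ->
   (forall z y, z \in D -> y \in H -> e z y -> [\/ y \in D, y = u, y = v | y = w]) -> closed_in e K D.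
  move=> inD nD; apply/closed_inP; split=> [|z y zD].
    by apply/subsetP => z /inD[? ? ? ?]; rewrite inK; apply/and4P.
  rewrite inK => /and4P[yw yu yv yH] ezy.
  by case: (nD z y zD yH ezy) => // E; move: yw yu yv; rewrite E eqxx.
have cBK : closed_in e K B.
  by apply: cK => // z y zB yH ezy; case: (nB z y zB yH ezy) => ?; [constructor 1|constructor 2|constructor 4].
have cBK' : closed_in e K B'.
  by apply: cK => // z y zB yH ezy; case: (nB' z y zB yH ezy) => ?; [constructor 1|constructor 3|constructor 4].
have oK : odd #|K|.
  rewrite /K odd_cardsDS ?cards1 ?addbT; last by rewrite sub1set !inE negb_or wH !(eq_sym w) nuw nvw.
  by apply: evK; apply: closed_in_refl.
have touch (D : {set T}) : closed_in e K D -> odd #|D| -> exists2 z, z \in D & e w z.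
  move=> /closed_inP[/subsetP sD HD] oD; apply/exists_inP; apply: contraT => /exists_inPn nt.
  suff /evK : closed_in e (H :\: [set u; v]) D by rewrite oD.
  apply/closed_inP; split=> [|z y zD yK ezy]; first by apply/subsetP => z /sD /setD1P[].
  have nzw := nt z zD.
  by apply: HD zD _ (ezy); rewrite in_setD1 yK andbT; apply: contraTneq ezy => ->; rewrite e_sym.
have oBB : odd #|B :\: B'| by rewrite odd_cardsD oB (negPf eI).
have oBB' : odd #|B' :\: B| by rewrite odd_cardsD oB' setIC (negPf eI).
have oR : odd #|K :\: B :\: B'|.
  rewrite odd_cardsD odd_cardsDS ?oK ?oB; last by case/closed_inP: cBK.
  have -> : (K :\: B) :&: B' = B' :\: B; last by rewrite oBB'.
  apply/setP => z; rewrite 2!inE [in RHS]inE; apply/andP/andP => -[h1 h2]; split=> //.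
    by case/andP: h1.
  by rewrite h1; case/closed_inP: cBK' => /subsetP/(_ z h2).
have cR : closed_in e K (K :\: B :\: B') by do 2 (apply: closed_inD => //); apply: closed_in_refl.
have [a aD ewa] := touch _ (closed_inD e_sym cBK cBK') oBB.
have [b bD ewb] := touch _ (closed_inD e_sym cBK' cBK) oBB'.
have [c cD ewc] := touch _ cR oR.
have sep (D : {set T}) z y : closed_in e K D -> z \in D -> y \in K -> y \notin D -> ~~ e z y /\ z != y.
  move=> /closed_inP[_ HD] zD yK yD; split; last by apply: contraNneq yD => <-.
  by apply: contra yD; apply: HD.
have /setDP[aB aB'] := aD; have /setDP[bB' bB] := bD.
have /setDP[/setDP[cK' cB''] cB'''] := cD.
have bK : b \in K by case/closed_inP: cBK' => /subsetP/(_ _ bB').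
have [? ?] := sep _ _ _ cBK aB bK bB.
have [? ?] := sep _ _ _ cBK aB cK' cB''.
have [? ?] := sep _ _ _ cBK' bB' cK' cB'''.
exact: (no_claw ewa ewb ewc).
Qed.

Lemma forced_petals : exists W B, petals e H u v W B.
Proof.
pose W := [set w in H | e u w && e v w].
have inW w : w \in W -> [/\ w \in H, e u w & e v w] by rewrite inE => /and3P[].
have evHC := all_evenP _ _ evH.
(* Pendant sets of minimum size are pairwise disjoint. *)
have exB w : exists C : {set T}, w \in W -> pendant w C /\ forall D, pendant w D -> #|C| <= #|D|.
  have [/inW[wH euw evw]|_] := boolP (w \in W); last by exists set0.
  have [C0 pC0] := pendant_ex wH euw evw.
  by case: (@arg_minnP _ C0 (pendant w) (fun C : {set T} => #|C|) pC0) => C pC minC; exists C.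
have [B0 HB0] := fin_all_exists exB.
have inB w z : w \in W -> z \in B0 w -> [/\ z \in H, z != u, z != v & z != w].
  by move=> /HB0[/pendantP[sC _ _] _] /sC.
have oddB w : w \in W -> odd #|B0 w| by move=> /HB0[/pendantP[]].
have nbB w z y : w \in W -> z \in B0 w -> y \in H -> e z y -> y \in B0 w \/ y = w.
  by move=> /HB0[/pendantP[_ _ nC] _]; apply: nC.
have BnW w z : w \in W -> z \in B0 w -> z \notin W.
  move=> wW zB; apply/negP => /inW[zH euz _].
  case: (nbB w z u wW zB uH); first by rewrite e_sym.
    by move=> uB; have [_ /eqP] := inB w u wW uB.
  by move=> E; have [_] := inW w wW; rewrite -E e_irr.
have disjB w w' z : w \in W -> w' \in W -> z \in B0 w -> z \in B0 w' -> w = w'.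
  move=> wW wW' zB zB'; apply/eqP; apply: contraT => nww.
  have cI : closed_in e H (B0 w :&: B0 w').
    apply/closed_inP; split=> [|x y /setIP[xB xB'] yH exy].
      by apply/subsetP => x /setIP[/(inB _ _ wW)[]].
    have [yB|yw] := nbB w x y wW xB yH exy; have [yB'|yw'] := nbB w' x y wW' xB' yH exy.
    - by rewrite inE yB.
    - by move: (BnW w y wW yB); rewrite yw' wW'.
    - by move: (BnW w' y wW' yB'); rewrite yw wW.
    by rewrite -yw yw' eqxx in nww.
  have [_ minB] := HB0 w wW.
  suff /minB : pendant w (B0 w :\: B0 w').
    rewrite leqNgt => /negP; case; apply: proper_card; apply/properP; split; first exact: subsetDl.
    by exists z => //; rewrite inE zB'.
  apply/pendantP; split=> [x /setDP[/(inB _ _ wW)]//||x y /setDP[xB xB'] yH exy].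
    by rewrite odd_cardsD (oddB w wW) (negPf (evHC _ cI)).
  case: (nbB w x y wW xB yH exy) => [yB|]; [left|by right].
  rewrite inE yB andbT; apply/negP => yB'.
  have xH : x \in H by case: (inB w x wW xB).
  rewrite e_sym in exy; case: (nbB w' y x wW' yB' xH exy) => [|xw']; first exact/negP.
  by move: (BnW w x wW xB); rewrite xw' wW'.
have touchB w : w \in W -> exists2 z, z \in B0 w & e w z.
  move=> wW; apply/exists_inP; apply: contraT => /exists_inPn nt.
  suff /evHC : closed_in e H (B0 w) by rewrite oddB.
  apply/closed_inP; split=> [|z y zB yH ezy]; first by apply/subsetP => z /(inB _ _ wW)[].
  case: (nbB w z y wW zB yH ezy) => // yw; have := nt z zB.
  by rewrite -yw e_sym ezy.
pose U := \bigcup_(w in W) (w |: B0 w).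
have inU z : reflect (z \in W \/ exists2 w, w \in W & z \in B0 w) (z \in U).
  apply: (iffP bigcupP) => [[w wW /setU1P[->|zB]]|[zW|[w wW zB]]]; [by left|by right; exists w| |].
    by exists z => //; rewrite setU11.
  by exists w => //; rewrite setU1r.
have [m Hm] := pmH.
(* A perfect matching of [H] maps the odd set [B0 x] into [x |: B0 x], so it mates [x] with a vertex
   of [B0 x]. Hence it restricts to [U] and to [H']. *)
have mU x : x \in U -> m x \in U.
  case/inU=> [xW|[w wW xB]]; apply/inU.
    right; exists x => //.
    have [z zB mz] : exists2 z, z \in B0 x & m z == x.
      apply/exists_inP; apply: contraT => /exists_inPn nm.
      suff /(pm_all_even e_irr)/all_evenP/(_ _ (closed_in_refl _ _)) : pm e (B0 x) by rewrite oddB.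
      exists m => z zB; have [zH _ _ _] := inB _ _ xW zB.
      have [mH mm em] := Hm z zH; split=> //.
      by case: (nbB x z (m z) xW zB mH em) => // E; have := nm z zB; rewrite E eqxx.
    have [zH _ _ _] := inB _ _ xW zB.
    by have [_ mm _] := Hm z zH; have -> : m x = z by rewrite -(eqP mz).
  have [xH _ _ _] := inB _ _ wW xB.
  have [mH mm em] := Hm x xH.
  by case: (nbB w x (m x) wW xB mH em) => [|->]; [right; exists w|left].
pose H' := H :\: U.
have uU : u \notin U.
  apply/inU => -[/inW[_]|[w wW /(inB _ _ wW)[_ /eqP//]]]; by rewrite e_irr.
have vU : v \notin U.
  apply/inU => -[/inW[_ _]|[w wW /(inB _ _ wW)[_ _ /eqP//]]]; by rewrite e_irr.
have uH' : u \in H' by rewrite inE uU.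
have vH' : v \in H' by rewrite inE vU.
have mH' x : x \in H' -> m x \in H'.
  move=> /setDP[xH xU]; have [mH mm _] := Hm x xH; rewrite inE mH andbT.
  by apply: contra xU => /mU; rewrite mm.
have pmH' : pm e H'.
  by exists m => x xH'; case/setDP: (xH') => /Hm[_ mm em] _; rewrite mH'.
have evH' := all_evenP _ _ (pm_all_even e_irr pmH').
have npmH' : ~ pm (del_edge e [set u; v]) H'.
  case=> m' Hm'; apply: npm; exists (fun x => if x \in H' then m' x else m x) => x xH.
  have [xH'|xH'] := boolP (x \in H').
    by have [mx mm em] := Hm' x xH'; rewrite mx mm em; case/setDP: mx.
  have [mH mm em] := Hm x xH.
  have xU : x \in U by move: xH'; rewrite inE xH andbT negbK.
  rewrite ifF; last by rewrite inE mU.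
  split=> //; rewrite del_edgeE em /=; apply/negP => /orP[]/andP[/eqP E _].
    by rewrite -E xU in uU.
  by rewrite -E xU in vU.
have [C cC [uC vC oC]] : exists2 C, closed_in (del_edge e [set u; v]) H' C &
    [/\ u \in C, v \notin C & odd #|C|].
  have [C cC oC] : exists2 C, closed_in (del_edge e [set u; v]) H' C & odd #|C|.
    apply/all_evenPn; apply/negP => /(sumner (del_edge_sym e_sym _) (del_edge_irr e_irr _)) pm'.
    apply: npmH'; apply: pm' => x a b c xH' aH' bH' cH'.
    (* Adjacency between two neighbours of [x] is lost only if they are [u] and [v], but then [x]
       would lie in [W]. *)
    have key p q : p \in H' -> q \in H' -> del_edge e [set u; v] x p ->
        del_edge e [set u; v] x q -> e p q -> del_edge e [set u; v] p q.
      move=> pH' qH'; rewrite !del_edgeE => /andP[xp _] /andP[xq _] epq.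
      rewrite epq /=; apply/negP => pq; case/setDP: xH' => xH /inU; case; left.
      by rewrite inE xH /=; case/orP: pq => /andP[/eqP E1 /eqP E2];
        rewrite -E1 -E2 !(e_sym _ x) xp xq.
    move=> xa xb xc ab ac bc; apply: contraT; rewrite !negb_or => /and3P[nab nac nbc].
    have e_of p : del_edge e [set u; v] x p -> e x p by rewrite del_edgeE => /andP[].
    by case: (no_claw (e_of _ xa) (e_of _ xb) (e_of _ xc)) => //;
       [apply: contra nab|apply: contra nac|apply: contra nbc]; apply: key.
  (* A set with both or neither of [u] and [v] is closed for [e] as well, hence even; so the odd set
     [C] separates [u] from [v]. *)
  have cCe : (u \in C) = (v \in C) -> ~~ odd #|C|.
    move=> uv; apply: evH'; have [sC HC] := closed_inP _ _ _ cC.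
    apply/closed_inP; split=> // x y xC yH' exy.
    have [pq|npq] := boolP ((x == u) && (y == v) || (x == v) && (y == u)).
      by case/orP: pq xC => /andP[/eqP-> /eqP->]; rewrite uv.
    by apply: HC xC yH' _; rewrite del_edgeE exy.
  have [uC|uC] := boolP (u \in C); have [vC|vC] := boolP (v \in C).
  - by move: oC; rewrite (negPf (cCe _)) // uC vC.
  - by exists C.
  - exists (H' :\: C); first by apply: closed_inC => //; apply: del_edge_sym.
    rewrite [u \in _]in_setD [v \in _]in_setD uC vC uH' odd_cardsDS; last by case/closed_inP: cC.
    by rewrite oC (negPf (evH' _ (closed_in_refl _ _))).
  by move: oC; rewrite (negPf (cCe _)) // (negPf uC) (negPf vC).
have [/subsetP sC HC] := closed_inP _ _ _ cC.
have cross x y : x \in C -> y \in H' -> y \notin C -> e x y -> x = u /\ y = v.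
  move=> xC yH' yC exy.
  have [|npq] := boolP ((x == u) && (y == v) || (x == v) && (y == u)).
    case/orP=> /andP[/eqP Ex /eqP Ey] //.
    by rewrite -Ex xC in vC.
  by move: yC; rewrite (HC x y xC yH') // del_edgeE exy.
(* The two sides of the bridge [uv] supply the petals of [u] and [v]; both sides are odd, so they
   become even without [u] and [v]. *)
pose B t := if t == u then C :\ u else if t == v then H' :\: C :\ v else B0 t.
have Bu : B u = C :\ u by rewrite /B eqxx.
have Bv : B v = H' :\: C :\ v by rewrite /B eq_sym (negPf nuv) eqxx.
have nWu : u \notin W by rewrite inE e_irr andbF.
have nWv : v \notin W by rewrite inE e_irr !andbF.
have BW w : w \in W -> B w = B0 w.
  by move=> wW; rewrite /B !ifF //; apply: contraTF wW => /eqP->.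
have coreP t : t \in [set u; v] :|: W -> [\/ t = u, t = v | t \in W].
  by case/setUP=> [/set2P[]|]; [constructor 1|constructor 2|constructor 3].
(* For any other [z], the potential claws at [w] on a vertex of its petal, on [z] and on [u] or [v]
   force [z] to be adjacent to both [u] and [v]. But [uv] is the only edge between [C] and the rest
   of [H']. *)
have H'W z w : z \in H' -> w \in W -> e z w -> z = u \/ z = v.
  move=> /setDP[zH zU] wW ezw; have [b bB ewb] := touchB w wW.
  have [wH euw evw] := inW w wW.
  have [|zu] := eqVneq z u; [by left|right]; apply/eqP; apply: contraT => zv.
  have nbz y : y \in H -> y \notin U -> ~~ e b y /\ b != y.
    move=> yH yU; split; last by apply: contraNneq yU => <-; apply/inU; right; exists w.
    apply/negP => eby; case/inU: yU.
    by case: (nbB w b y wW bB yH eby) => [|->]; [right; exists w|left].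
  have [nbz1 nbz2] := nbz z zH zU.
  have [nbu1 nbu2] := nbz u uH uU.
  have [nbv1 nbv2] := nbz v vH vU.
  rewrite e_sym in euw; rewrite e_sym in evw; rewrite e_sym in ezw.
  have zH' : z \in H' by rewrite inE zU.
  have nz : e z u && e z v.
    apply/andP; split; apply: contraT => nzz.
      by case: (no_claw ewb ezw euw).
    by case: (no_claw ewb ezw evw).
  case/andP: nz => nzu nzv.
  have [zC|zC] := boolP (z \in C).
    by have [E _] := cross z v zC vH' vC nzv; rewrite E eqxx in zu.
  have euz : e u z by rewrite e_sym.
  by have [_ E] := cross u z uC zH' zC euz; rewrite E eqxx in zv.
exists W, B; split=> //.
- move=> z zH; have [/inU[zW|[w wW zB]]|zU] := boolP (z \in U).
  + by left; rewrite inE zW orbT.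
  + by right; exists w; rewrite ?BW // inE wW orbT.
  have [->|zu] := eqVneq z u; first by left; rewrite !inE eqxx.
  have [->|zv] := eqVneq z v; first by left; rewrite !inE eqxx orbT.
  right; have [zC|zC] := boolP (z \in C).
    by exists u; rewrite ?Bu !inE ?eqxx ?zu.
  by exists v; rewrite ?Bv !inE ?eqxx ?orbT ?zv ?zC ?zU.
- have HC' z : z \in H' -> z != u -> z != v -> z \in H /\ z \notin [set u; v] :|: W.
    move=> /setDP[zH zU] zu zv; split=> //; rewrite !in_setU !in_set1 !negb_or zu zv.
    by apply: contra zU => zW; apply/inU; left.
  move=> t z /coreP[->|->|wW].
  + rewrite Bu => /setD1P[zu zC]; apply: HC' => //; first exact: sC.
    by apply: contraNneq vC => <-.
  + rewrite Bv => /setD1P[zv /setDP[zH' zC]]; apply: HC' => //.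
    by apply: contraNneq zC => ->.
  rewrite BW // => zB; have [zH zu zv _] := inB t z wW zB; split=> //.
  by rewrite !in_setU !in_set1 !negb_or zu zv; apply: BnW zB.
- have HU x y : x \in H' -> x != u -> x != v -> y \in H -> e x y -> y \in H'.
    move=> xH' xu xv yH exy; rewrite inE yH andbT; apply/inU => -[yW|[w wW yB]].
      by case: (H'W x y xH' yW exy) => E; [rewrite E eqxx in xu|rewrite E eqxx in xv].
    case/setDP: xH' => xH /inU; case; rewrite e_sym in exy.
    by case: (nbB w y x wW yB xH exy) => [|->]; [right; exists w|left].
  move=> t z y /coreP[->|->|wW].
  + rewrite Bu => /setD1P[zu zC] yH ezy.
    have zv : z != v by apply: contraNneq vC => <-.
    have yH' := HU z y (sC z zC) zu zv yH ezy.
    have [->|yu] := eqVneq y u; [by right|left]; rewrite in_setD1 yu /=.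
    by apply: contraT => yC; have [E _] := cross z y zC yH' yC ezy; rewrite E eqxx in zu.
  + rewrite Bv => /setD1P[zv /setDP[zH' zC]] yH ezy.
    have zu : z != u by apply: contraNneq zC => ->.
    have yH' := HU z y zH' zu zv yH ezy.
    have [->|yv] := eqVneq y v; [by right|left]; rewrite in_setD1 yv in_setD yH' andbT.
    apply/negP => yC; rewrite e_sym in ezy.
    by have [_ E] := cross y z yC zH' zC ezy; rewrite E eqxx in zv.
  by rewrite BW //; apply: nbB.
- have dU w z : w \in W -> z \in B0 w -> z \in H' -> False.
    by move=> wW zB /setDP[_ /inU]; case; right; exists w.
  move=> t t' z /coreP[->|->|tW] /coreP[->|->|tW'] //; rewrite ?Bu ?Bv ?BW //.
  + by move=> /setD1P[_ zC] /setD1P[_ /setDP[_]]; rewrite zC.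
  + by move=> /setD1P[_ /sC zH'] zB; case: (dU t' z).
  + by move=> /setD1P[_ /setDP[_ zC]] /setD1P[_]; rewrite (negPf zC).
  + by move=> /setD1P[_ /setDP[zH' _]] zB; case: (dU t' z).
  + by move=> zB /setD1P[_ /sC zH']; case: (dU t z).
  + by move=> zB /setD1P[_ /setDP[zH' _]]; case: (dU t z).
  exact: disjB.
- by move=> w wW; rewrite BW // oddB.
- by move=> w wW; rewrite BW //; apply: touchB.
move=> t /set2P[->|->].
  by rewrite Bu odd_cardsDS ?sub1set // cards1 oC.
rewrite Bv odd_cardsDS ?cards1; last by rewrite sub1set in_setD vC vH'.
rewrite odd_cardsDS; last by case/closed_inP: cC.
by rewrite oC (negPf (evH' _ (closed_in_refl _ _))).
Qed.

End Forced.

(** * Minimum degree at least four *)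

Ltac neq_hyps := repeat match goal with
  | H : is_true (~~ (_ || _)) |- _ => rewrite negb_or in H
  | H : is_true (_ && _) |- _ =>
      let H1 := fresh in let H2 := fresh in move/andP: H => [H1 H2]
  | H : is_true (~~ in_mem _ _) |- _ => rewrite !inE in H
  | H : is_true (uniq _) |- _ => rewrite /= !inE in H
  end.

Ltac neq := neq_hyps; rewrite /= ?inE ?negb_or ?andbT;
  repeat (apply/andP; split); first [done | by rewrite eq_sym].

Definition boundary (T : finType) (e : rel T) (F : {set T}) : {set T} :=
  [set z | (z \notin F) && [exists x in F, e x z]].

Section LowDegree.
Variables (T : finType) (e : rel T).
Hypotheses (e_sym : symmetric e) (e_irr : irreflexive e).
Implicit Types F C : {set T}.

Lemma boundaryP F z :
  reflect (z \notin F /\ exists2 x, x \in F & e x z) (z \in boundary e F).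
Proof.
rewrite inE; apply: (iffP andP) => [[zF /exists_inP]//|[zF H]].
by split=> //; apply/exists_inP.
Qed.

Lemma boundary_sub F (S : {set T}) :
  (forall x y, x \in F -> e x y -> y \in F \/ y \in S) -> boundary e F \subset S.
Proof.
move=> H; apply/subsetP => z /boundaryP[zF [x xF exz]].
by case: (H x z xF exz) => //; rewrite (negPf zF).
Qed.

Lemma boundary_or F x y : x \in F -> e x y -> y \in F \/ y \in boundary e F.
Proof.
move=> xF exy; have [yF|yF] := boolP (y \in F); [by left|right].
by apply/boundaryP; split=> //; exists x.
Qed.

Lemma connected_boundary F : connected e -> F != set0 -> boundary e F = set0 -> F = [set: T].
Proof.
move=> /forallP con /set0Pn[x xF] bF; apply/setP => y; rewrite [RHS]inE.
have /connectP[p] := forallP (con x) y; elim: p x xF => [|z p IHp] x xF /= => [_ -> //|/andP[exz pz]].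
by apply: IHp => //; case: (boundary_or xF exz) => //; rewrite bF inE.
Qed.

Hypothesis ext_pm : forall a b c d, e a b -> e c d -> uniq [:: a; b; c; d] ->
  pm e (~: [set a; b; c; d]).

(** Extending the two edges gives a perfect matching of the complement of their ends, in which [C]
    is a union of components. *)
Lemma ext2 a b c d C : e a b -> e c d -> uniq [:: a; b; c; d] ->
  [disjoint C & [set a; b; c; d]] -> boundary e C \subset [set a; b; c; d] -> ~~ odd #|C|.
Proof.
move=> eab ecd U D sC; have /(pm_all_even e_irr)/all_evenP := ext_pm eab ecd U.
apply; apply/closed_inP; split; first by rewrite -disjoints_subset.
move=> x y xC; rewrite in_setC => yY exy; case: (boundary_or xC exy) => // /(subsetP sC).
by rewrite (negPf yY).
Qed.

Lemma ext2_vertex a b c d x : e a b -> e c d -> uniq [:: a; b; c; d] ->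
  x \notin [set a; b; c; d] -> exists2 y, e x y & y \notin [set a; b; c; d].
Proof.
move=> eab ecd U xY.
apply/exists_inP; apply: contraT => /exists_inPn nex.
have : ~~ odd #|[set x]|; last by rewrite cards1.
apply: (ext2 eab ecd U).
  by rewrite disjoint_sym disjoints_subset; apply/subsetP => z zY; rewrite in_setC in_set1; apply: contraNneq xY => <-.
apply: boundary_sub => _ y /set1P-> exy; right; apply: contraT => /negP yY.
by have := nex y exy; rewrite negbK => /yY.
Qed.

Hypothesis conn : forall F, F != set0 -> boundary e F = set0 -> F = [set: T].
Hypothesis claw : clawless e [set: T].
Hypothesis T6 : 6 <= #|T|.
Hypothesis pmT : pm e [set: T].

Lemma ext1_vertex a b x : e a b -> x \notin [set a; b] -> exists2 y, e x y & y \notin [set a; b].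
Proof.
move=> eab xab.
have [m Hm] := pmT.
have mm y : m (m y) = y by have [] := Hm y (in_setT _).
have em y : e y (m y) by have [] := Hm y (in_setT _).
have [mx|mx] := boolP (m x \in [set a; b]); last by exists (m x).
have nab := rel_neq e_irr eab.
(* Otherwise the mate function would inject the complement of [{a, b, x}], which has at least three
   vertices, into [{a, b}]. *)
have [c [d [ecd cS dS]]] : exists c d, [/\ e c d, c \notin [set a; b; x] & d \notin [set a; b; x]].
  case: (boolP [exists c in ~: [set a; b; x], exists d in ~: [set a; b; x], e c d]).
    by case/exists_inP=> c cS /exists_inP[d dS ecd]; exists c, d; rewrite -!in_setC.
  move=> nex; exfalso.
  have inj : injective m by apply: can_inj mm.
  have sub : m @: (~: [set a; b; x]) \subset [set a; b].
    apply/subsetP => _ /imsetP[y yS ->].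
    apply: contraT => myab; case/negP: nex; apply/exists_inP; exists y => //.
    apply/exists_inP; exists (m y) => //; rewrite in_setC in_setU (negPf myab) in_set1 /=.
    by apply: contraTneq yS => E; rewrite inE negbK in_setU -(mm y) E mx.
  have := subset_leq_card sub; rewrite card_imset // cards2 nab.
  have := cardsC [set a; b; x]; rewrite setUC cardsU1 cards2; lia.
have ncd := rel_neq e_irr ecd.
have U : uniq [:: a; b; c; d] by neq.
have xS : x \notin [set a; b; c; d] by neq.
have [y exy yS] := ext2_vertex eab ecd U xS.
by exists y => //; neq.
Qed.

Lemma small_boundary F : 0 < #|F| <= 4 -> exists2 z, z \notin F & exists2 y, y \in F & e y z.
Proof.
case/andP; rewrite card_gt0 => F0 F4; have [/(conn F0) FT|[z /boundaryP[]]] := set_0Vmem (boundary e F).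
  by have := cardsT T; rewrite -FT; lia.
by exists z.
Qed.

Definition nbrs x := [set y | e x y].

Lemma in_nbrs x y : (y \in nbrs x) = e x y.
Proof. by rewrite inE. Qed.

(** With a single neighbour [a] of [x], connectivity gives an edge [ab] with [b] different from [x],
    and its removal isolates [x]. *)
Lemma degree_ge2 x : 1 < #|nbrs x|.
Proof.
rewrite ltnNge; apply/negP => le1.
have [a Na] : exists a, forall y, e x y -> y = a.
  case: (set_0Vmem (nbrs x)) => [N0|[a aN]].
    by exists x => y; rewrite -in_nbrs N0 inE.
  exists a => y exy; apply: (card_le1_eqP le1) => //; by rewrite in_nbrs.
have [|b bF [y yF eyb]] := small_boundary (F := [set x; a]).
  by rewrite cards2; case: (x != a).
have eab : e a b.
  by case/set2P: yF eyb => -> // /Na E; rewrite E set22 in bF.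
have nxa : x != a.
  by apply/eqP => E; have := Na b; rewrite E => /(_ eab) Eb; rewrite Eb set22 in bF.
have [|z exz] := ext1_vertex eab (x := x); last by rewrite (Na z exz) set21.
by neq.
Qed.

(** If [a] and [b] are the only neighbours of [x], they are not adjacent, and their neighbours other
    than [x] coincide: distinct ones would give disjoint edges at [a] and [b] that isolate [x]. So
    [a] and [b] share one further neighbour [a']. With an edge [a'd] leaving these four vertices,
    [ax] and [a'd] isolate [b]. *)
Lemma degree_ge3 x : 2 < #|nbrs x|.
Proof.
rewrite ltnNge; apply/negP => le2.
have /eqP/cards2P[a [b [nab Nx]]] : #|nbrs x| = 2 by have := degree_ge2 x; lia.
have Nx' y : e x y -> y = a \/ y = b by rewrite -in_nbrs Nx => /set2P.
have exa : e x a by rewrite -in_nbrs Nx set21.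
have exb : e x b by rewrite -in_nbrs Nx set22.
have eax : e a x by rewrite e_sym.
have ebx : e b x by rewrite e_sym.
have nxa := rel_neq e_irr exa; have nxb := rel_neq e_irr exb.
have eab : ~~ e a b.
  apply/negP => eab; have [|y exy] := ext1_vertex eab (x := x); first by neq.
  by case: (Nx' y exy) => ->; rewrite !inE eqxx ?orbT.
have other y z : exists2 w, e y w & w != z.
  have := degree_ge2 y; rewrite (cardD1 z) => lt.
  have /card_gt0P[w] : 0 < #|[predD1 nbrs y & z]| by lia.
  by rewrite !inE => /andP[wz eyw]; exists w.
have pairs a' b' : e a a' -> e b b' -> a' != x -> b' != x -> a' = b'.
  move=> ea eb na nb; apply/eqP; apply: contraT => nab'.
  have ne1 := rel_neq e_irr ea; have ne2 := rel_neq e_irr eb.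
  have ne3 : a' != b by apply: contraNneq eab => <-.
  have ne4 : b' != a by apply: contraNneq eab => <-; rewrite e_sym.
  have [||y exy] := ext2_vertex (x := x) ea eb; [by neq|by neq|].
  by case: (Nx' y exy) => ->; rewrite !inE eqxx ?orbT.
have [a' eaa' na'x] := other a x.
have [b' ebb' nb'x] := other b x.
have Eb := pairs a' b' eaa' ebb' na'x nb'x; subst b'.
have Na y : e a y -> y = x \/ y = a'.
  by move=> eay; have [|nyx] := eqVneq y x; [left|right; apply: pairs ebb' nyx na'x].
have Nb y : e b y -> y = x \/ y = a'.
  by move=> eby; have [|nyx] := eqVneq y x; [left|right; rewrite (pairs a' y)].
have [|d dF [y yF eyd]] := small_boundary (F := x |: (a |: [set b; a'])).
  by rewrite !cardsU1 cards1; do 3 case: (_ \notin _).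
have ead : e a' d.
  move: yF eyd dF; rewrite !inE !negb_or => /or4P[]/eqP-> // H /and4P[/eqP ? /eqP ? /eqP ? /eqP ?].
  + by case: (Nx' d H).
  + by case: (Na d H).
  by case: (Nb d H).
have ne1 := rel_neq e_irr eaa'; have ne2 := rel_neq e_irr ebb'; have ne3 := rel_neq e_irr ead.
have [||z ebz] := ext2_vertex (x := b) eax ead; [by neq|by neq|].
by case: (Nb z ebz) => ->; rewrite !inE eqxx ?orbT.
Qed.

(** Two of the three neighbours, say [a] and [b], are adjacent. An edge [cd] leaving [{x, a, b, c}]
    would together with [ab] isolate [x]; so [c], of degree at least three, is adjacent to exactly
    [x], [a] and [b]. By symmetry no edge leaves these four vertices, against connectivity. *)
Lemma degree_ge4 x : 3 < #|nbrs x|.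
Proof.
rewrite ltnNge; apply/negP => le3.
have N3 : #|nbrs x| = 3 by have := degree_ge3 x; lia.
have [a aN] : exists a, a \in nbrs x by apply/set0Pn; rewrite -card_gt0 N3.
have /cards2P[b [c [nbc Nx]]] : #|nbrs x :\ a| == 2.
  by have := cardsD1 a (nbrs x); rewrite aN N3; lia.
have key a1 b1 c1 : a1 != b1 -> a1 != c1 -> b1 != c1 -> nbrs x = a1 |: [set b1; c1] -> e a1 b1 -> e c1 a1 /\ e c1 b1.
  move=> nab nac nbc' Nx' eab; have := degree_ge3 c1.
  have exN y : y \in nbrs x -> x != y by rewrite in_nbrs; apply: rel_neq.
  have nxa : x != a1 by apply: exN; rewrite Nx' !inE eqxx.
  have nxb : x != b1 by apply: exN; rewrite Nx' !inE eqxx ?orbT.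
  have nxc : x != c1 by apply: exN; rewrite Nx' !inE eqxx ?orbT.
  have sub : nbrs c1 \subset x |: [set a1; b1].
    apply/subsetP => d; rewrite in_nbrs => ecd; apply: contraT => dS.
    have ncd := rel_neq e_irr ecd.
    have [||y] := ext2_vertex (x := x) eab ecd; [by neq|by neq|].
    by rewrite -in_nbrs Nx' !inE => /or3P[]/eqP->; rewrite eqxx ?orbT.
  have c3 : #|x |: [set a1; b1]| = 3 by rewrite cardsU1 cards2 nab inE !in_set1 (negPf nxa) (negPf nxb).
  move=> gt2; have E : nbrs c1 = x |: [set a1; b1] by apply/eqP; rewrite eqEcard sub c3.
  by rewrite -!in_nbrs E !inE !eqxx ?orbT.
have Nabc : nbrs x = a |: [set b; c] by rewrite -Nx setD1K.
have nab : a != b by have : b \in nbrs x :\ a by [rewrite Nx set21]; rewrite in_setD1 eq_sym => /andP[].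
have nac : a != c by have : c \in nbrs x :\ a by [rewrite Nx set22]; rewrite in_setD1 eq_sym => /andP[].
have exN y : y \in nbrs x -> e x y by rewrite in_nbrs.
have exa : e x a by apply: exN; rewrite Nabc !inE eqxx.
have exb : e x b by apply: exN; rewrite Nabc !inE eqxx ?orbT.
have exc : e x c by apply: exN; rewrite Nabc !inE eqxx ?orbT.
wlog eab : a b c {aN Nx} nbc Nabc nab nac exa exb exc / e a b.
  move=> W; have := claw (in_setT x) (in_setT a) (in_setT b) (in_setT c) exa exb exc nab nac nbc.
  case/or3P=> H; first exact: (W a b c).
    by apply: (W a c b) => //; rewrite 1?eq_sym // [[set c; b]]setUC.
  apply: (W b c a) => //; rewrite 1?[b == _]eq_sym 1?[c == _]eq_sym // Nabc.
  by apply/setP => z; rewrite !inE; case: (z == a); case: (z == b); case: (z == c).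
have [eca ecb] := key a b c nab nac nbc Nabc eab.
have perm2 : nbrs x = a |: [set c; b] by rewrite Nabc [[set c; b]]setUC.
have perm3 : nbrs x = b |: [set c; a].
  by rewrite Nabc; apply/setP => z; rewrite !inE; case: (z == a); case: (z == b); case: (z == c).
have clos a1 b1 c1 : a1 != b1 -> a1 != c1 -> b1 != c1 -> nbrs x = a1 |: [set b1; c1] -> e a1 b1 ->
    forall d, e c1 d -> d \in x |: (a1 |: [set b1; c1]).
  move=> n1 n2 n3 Nx1 e1 d ecd; apply: contraT => dS.
  have ncd := rel_neq e_irr ecd.
  have nx y : y \in nbrs x -> x != y by rewrite in_nbrs; apply: rel_neq.
  have nxa : x != a1 by apply: nx; rewrite Nx1 !inE eqxx.
  have nxb : x != b1 by apply: nx; rewrite Nx1 !inE eqxx ?orbT.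
  have nxc : x != c1 by apply: nx; rewrite Nx1 !inE eqxx ?orbT.
  have [||y] := ext2_vertex (x := x) e1 ecd; [by neq|by neq|].
  by rewrite -in_nbrs Nx1 !inE => /or3P[]/eqP->; rewrite eqxx ?orbT.
have [|d dF [y yF eyd]] := small_boundary (F := x |: (a |: [set b; c])).
  by rewrite !cardsU1 cards1; do 3 case: (_ \notin _).
case/negP: dF; case/setU1P: yF eyd => [->|]; first by rewrite -in_nbrs Nabc => dN; rewrite in_setU1 dN orbT.
case/setU1P=> [->|/set2P[->|->]] eyd.
- have := clos b c a; rewrite perm3 => /(_ _ _ _ erefl) H.
  have := H; rewrite -perm3 Nabc; apply=> //; by rewrite ?[b == _]eq_sym ?[c == _]eq_sym // e_sym.
- have := clos a c b; rewrite perm2 => /(_ _ _ _ erefl) H.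
  have := H; rewrite -perm2 Nabc; apply=> //; by rewrite ?[c == _]eq_sym // e_sym.
by apply: clos eyd.
Qed.

End LowDegree.

(** * Connectivity and incidence counting *)

(** Turning the cardinals into variables and clearing the context keeps the arithmetic problem small
    for [lia]. *)
Ltac card_lia :=
  repeat match goal with
  | H : is_true (leq _ _) |- _ => revert H
  | H : @eq nat _ _ |- _ => revert H
  end; clear;
  repeat match goal with |- context [#|?A|] => move: #|A| => ? end; lia.

Lemma card_setI_sum (T : finType) (S A : {set T}) : #|S :&: A| = \sum_(z in S) (z \in A).
Proof. by rewrite -sum1_card -big_mkcondr; apply: eq_bigl => z; rewrite inE. Qed.

Lemma card_partition3 (T : finType) (A B C S : {set T}) :
  (forall z, z \in S -> (z \in A) + (z \in B) + (z \in C) = 1) ->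
  #|S| = #|S :&: A| + #|S :&: B| + #|S :&: C|.
Proof.
move=> H; rewrite !card_setI_sum -!big_split -sum1_card.
by apply: eq_bigr => z zS /=; rewrite H.
Qed.

Lemma card_sub3 (T : finType) (S A B C : {set T}) :
  (forall z, z \in S -> [\/ z \in A, z \in B | z \in C]) -> #|S| <= #|A| + #|B| + #|C|.
Proof.
move=> H; apply: (@leq_trans #|A :|: B :|: C|).
  apply/subset_leq_card/subsetP => z /H; rewrite !inE.
  by case=> ->; rewrite ?orbT.
by rewrite (leq_trans (leq_card_setU _ _)) // leq_add2r leq_card_setU.
Qed.

Section Dense.
Variables (T : finType) (e : rel T).
Hypotheses (e_sym : symmetric e) (e_irr : irreflexive e).
Hypothesis ext_pm : forall a b c d, e a b -> e c d -> uniq [:: a; b; c; d] ->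
  pm e (~: [set a; b; c; d]).
Hypothesis conn : forall F : {set T}, F != set0 -> boundary e F = set0 -> F = [set: T].
Hypothesis claw : clawless e [set: T].
Hypothesis evT : ~~ odd #|T|.
Hypothesis deg6 : forall x, 6 <= #|nbrs e x|.
Implicit Types F C S : {set T}.

Lemma nbr_avoiding x S : #|S| < 6 -> exists2 y, e x y & y \notin S.
Proof.
move=> S6; apply/exists_inP; apply: contraT => /exists_inPn nex.
suff /subset_leq_card : nbrs e x \subset S by have := deg6 x; card_lia.
by apply/subsetP => y; rewrite in_nbrs => /nex; rewrite negbK.
Qed.

(** A second edge [cd] outside [{a, b}] completes the matching; it lies entirely inside or entirely
    outside [C], so the parity of [C] is not affected. *)
Lemma ext1 a b C : e a b -> [disjoint C & [set a; b]] -> boundary e C \subset [set a; b] ->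
  ~~ odd #|C|.
Proof.
move=> eab D sC.
have c2 : #|[set a; b]| < 6 by rewrite cards2; case: (a != b).
have [c _ cab] := nbr_avoiding a c2.
have [d ecd dab] := nbr_avoiding c c2.
have nab := rel_neq e_irr eab; have ncd := rel_neq e_irr ecd.
have U : uniq [:: a; b; c; d] by neq.
have sub2 : [set a; b] \subset [set a; b; c; d].
  by apply/subsetP => z /set2P[]->; rewrite !inE eqxx ?orbT.
have nCab z : z \in C -> z \notin [set a; b] by move=> zC; rewrite (disjointFr D zC).
have step x y : x \in C -> e x y -> y \notin [set a; b] -> y \in C.
  move=> xC exy yab; case: (boundary_or xC exy) => // /(subsetP sC).
  by rewrite (negPf yab).
have [cC|cC] := boolP (c \in C).
  rewrite -(odd_cardsD2 cC (step c d cC ecd dab) ncd).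
  apply: (ext2 e_irr ext_pm eab ecd U).
    rewrite disjoints_subset; apply/subsetP => z /setDP[/nCab zab zcd].
    by rewrite in_setC; neq.
  apply: boundary_sub => x y /setDP[xC _] exy.
  have [yab|yab] := boolP (y \in [set a; b]); first by right; apply: (subsetP sub2).
  have yC := step x y xC exy yab.
  rewrite in_setD yC andbT; have [ycd|_] := boolP (y \in [set c; d]); [right|by left].
  by case/set2P: ycd => ->; rewrite !inE eqxx ?orbT.
have dC : d \notin C by apply: contra cC => dC; apply: (step d c dC) => //; rewrite e_sym.
apply: (ext2 e_irr ext_pm eab ecd U); last exact: subset_trans sC sub2.
rewrite disjoints_subset; apply/subsetP => z zC; rewrite in_setC.
have := nCab z zC; have : z != c by apply: contraNneq cC => <-.
have : z != d by apply: contraNneq dC => <-.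
by move=> *; neq.
Qed.

Lemma boundary_compl F S : boundary e F \subset S -> boundary e (~: (F :|: S)) \subset S.
Proof.
move=> sF; apply: boundary_sub => x y; rewrite !in_setC => xFS exy.
have [yFS|] := boolP (y \in F :|: S); [right|by left].
case/setUP: yFS => // yF; rewrite e_sym in exy.
move: xFS; rewrite in_setU; case: (boundary_or yF exy) => [->//|/(subsetP sF)->].
by rewrite orbT.
Qed.

Lemma boundary_touch F s S : ~~ (boundary e F \subset S) -> boundary e F \subset s |: S ->
  exists2 f, f \in F & e s f.
Proof.
move=> /subsetPn[z zF zS] /subsetP/(_ z zF); rewrite in_setU1 (negPf zS) orbF => /eqP E.
by case/boundaryP: zF => _ [x xF]; rewrite E e_sym; exists x.
Qed.

(** As [T] is even, exactly one of the two sides is odd; but an edge from [s] into the other side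
    cuts it off, contrary to [ext1]. *)
Lemma no_cut1 F s z : F != set0 -> boundary e F \subset [set s] -> s \notin F ->
  z \notin F -> z != s -> False.
Proof.
move=> F0 sF nsF nzF nzs; pose Z := ~: (F :|: [set s]).
have Z0 : Z != set0 by apply/set0Pn; exists z; rewrite in_setC in_setU in_set1 (negPf nzF).
have sZ : boundary e Z \subset [set s] by apply: boundary_compl.
have touch G : G != set0 -> s \notin G -> boundary e G \subset [set s] -> exists2 f, f \in G & e s f.
  move=> G0 sG bG; apply: (@boundary_touch _ s set0); last by rewrite setU0.
  by rewrite subset0; apply: contraNneq sG => /(conn G0) ->; rewrite inE.
have nsZ : s \notin Z by rewrite !inE eqxx orbT.
have [f fF esf] := touch F F0 nsF sF.
have [g gZ esg] := touch Z Z0 nsZ sZ.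
have par : odd #|F| (+) odd #|Z|.
  have := cardsC (F :|: [set s]); rewrite -/Z setUC cardsU1 nsF => /(congr1 odd).
  by rewrite (negPf evT) !oddD /=; case: (odd #|F|); case: (odd #|Z|).
have dis (G G' : {set T}) x : s \notin G -> (forall z, z \in G -> z \notin G') -> x \in G' -> [disjoint G & [set s; x]].
  move=> sG GG' xG'; rewrite disjoints_subset; apply/subsetP => y yG; rewrite in_setC !inE negb_or.
  by apply/andP; split; [apply: contraNneq sG => <-|apply: contraTneq yG => ->; apply: contraL (xG') => /GG'].
have s12 x : [set s] \subset [set s; x] by rewrite sub1set set21.
have FZ y : y \in F -> y \notin Z by move=> yF; rewrite !inE yF.
have ZF y : y \in Z -> y \notin F by apply: contraTN => /FZ.
have := ext1 esf (dis Z F f nsZ ZF fF) (subset_trans sZ (s12 f)).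
have := ext1 esg (dis F Z g nsF FZ gZ) (subset_trans sF (s12 g)).
by move: par; case: odd; case: odd.
Qed.

(** An edge from [s] into [F] and one from [t] into the other side [Z] show that [F] is odd, hence
    [Z] too. Two disjoint edges from [s] and [t] into [F] then cut off [Z]. *)
Lemma no_cut2 F s t z : s != t -> F != set0 -> boundary e F \subset [set s; t] ->
  s \notin F -> t \notin F -> z \notin F -> z != s -> z != t -> False.
Proof.
move=> nst F0 sF nsF ntF nzF nzs nzt; pose Z := ~: (F :|: [set s; t]).
have zZ : z \in Z by rewrite /Z !inE !negb_or nzF nzs.
have Z0 : Z != set0 by apply/set0Pn; exists z.
have sZ : boundary e Z \subset [set s; t] by apply: boundary_compl.
have nsZ : s \notin Z by rewrite !inE eqxx orbT.
have ntZ : t \notin Z by rewrite !inE eqxx !orbT.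
have [f0 f0F] := set0Pn _ F0.
have FZ y : y \in F -> y \notin Z by move=> yF; rewrite !inE yF.
have touchs G y : G != set0 -> s \notin G -> t \notin G -> y \notin G -> y != t ->
    boundary e G \subset [set s; t] -> exists2 f, f \in G & e s f.
  move=> G0 sG tG yG yt bG; apply: (boundary_touch (S := [set t])) => //.
  by apply/negP => bt; apply: (no_cut1 G0 bt tG yG).
have toucht G y : G != set0 -> s \notin G -> t \notin G -> y \notin G -> y != s ->
    boundary e G \subset [set s; t] -> exists2 f, f \in G & e t f.
  move=> G0 sG tG yG ys bG; apply: (boundary_touch (S := [set s])); last by rewrite setUC.
  by apply/negP => bt; apply: (no_cut1 G0 bt sG yG).
have [f fF esf] := touchs F z F0 nsF ntF nzF nzt sF.
have nf0s : f0 != s by apply: contraNneq nsF => <-.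
have [g gZ etg] := toucht Z f0 Z0 nsZ ntZ (FZ _ f0F) nf0s sZ.
have gF : g \notin F by apply: contraTN gZ => /FZ.
have nsf := rel_neq e_irr esf; have ntg := rel_neq e_irr etg.
have nsg : s != g by apply: contraNneq nsZ => ->.
have ntf : t != f by apply: contraNneq ntF => ->.
have nfg : f != g by apply: contraNneq gF => <-.
have U : uniq [:: s; f; t; g] by neq.
have evF : odd #|F|.
  have := ext2 (C := F :\ f) e_irr ext_pm esf etg U.
  rewrite odd_cardsDS ?sub1set // cards1 addbT negbK; apply.
    rewrite disjoints_subset; apply/subsetP => y /setD1P[yf yF]; rewrite in_setC.
    have ys : y != s by apply: contraNneq nsF => <-.
    have yt : y != t by apply: contraNneq ntF => <-.
    have yg : y != g by apply: contraNneq gF => <-.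
    by neq.
  apply: boundary_sub => x y /setD1P[_ xF] exy.
  have [->|yf] := eqVneq y f; first by right; rewrite !inE eqxx !orbT.
  rewrite in_setD1 yf; case: (boundary_or xF exy) => [|/(subsetP sF) yS]; [by left|right].
  by case/set2P: yS => ->; rewrite !inE eqxx ?orbT.
have [f' f'F etf'] := toucht F z F0 nsF ntF nzF nzs sF.
(* If [s] and [t] reach [F] at the same vertex [f], then [s] or [t] has another neighbour in [F],
   since [f] alone cannot cut off the rest of [F]. *)
have [g1 [g2 [g1F g2F esg1 etg2 n12]]] : exists g1 g2, [/\ g1 \in F, g2 \in F, e s g1, e t g2 & g1 != g2].
  have [E|] := eqVneq f f'; last by exists f, f'.
  subst f'; have [h efh hS] : exists2 y, e f y & y \notin [set s; t].
    by apply: nbr_avoiding; rewrite cards2 nst.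
  have hF : h \in F by case: (boundary_or fF efh) => // /(subsetP sF); rewrite (negPf hS).
  have nfh := rel_neq e_irr efh.
  have bF' : boundary e (F :\ f) \subset [set f; s; t].
    apply: boundary_sub => x y /setD1P[_ xF] exy; have [->|yf] := eqVneq y f; first by right; rewrite !inE eqxx.
    rewrite in_setD1 yf; case: (boundary_or xF exy) => [|/(subsetP sF) yS]; [by left|right].
    by case/set2P: yS => ->; rewrite !inE eqxx ?orbT.
  have : ~~ (boundary e (F :\ f) \subset [set f]).
    apply/negP => bf; apply: (no_cut1 (z := z) _ bf).
    - by apply/set0Pn; exists h; rewrite !inE eq_sym nfh.
    - by rewrite !inE eqxx.
    - by rewrite in_setD1 (negPf nzF) andbF.
    by apply: contraNneq nzF => ->.
  case/subsetPn=> y yb; rewrite in_set1 => nyf.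
  have /boundaryP[_ [x /setD1P[xf xF] exy]] := yb.
  have := subsetP bF' y yb; rewrite !inE (negPf nyf) /= => /orP[]/eqP E; rewrite E e_sym in exy.
    by exists x, f.
  by exists f, x; split=> //; rewrite eq_sym.
have nsg1 := rel_neq e_irr esg1; have ntg2 := rel_neq e_irr etg2.
have nsg2 : s != g2 by apply: contraNneq nsF => ->.
have ntg1 : t != g1 by apply: contraNneq ntF => ->.
have U2 : uniq [:: s; g1; t; g2] by neq.
have : ~~ odd #|Z|.
  apply: (ext2 e_irr ext_pm esg1 etg2 U2).
    rewrite disjoints_subset; apply/subsetP => y yZ; rewrite in_setC.
    have ys : y != s by apply: contraNneq nsZ => <-.
    have yt : y != t by apply: contraNneq ntZ => <-.
    have yg1 : y != g1 by apply: contraTneq yZ => ->; apply: FZ.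
    have yg2 : y != g2 by apply: contraTneq yZ => ->; apply: FZ.
    by neq.
  apply: subset_trans sZ _; apply/subsetP => y /set2P[->|->]; by rewrite !inE eqxx ?orbT.
have := cardsC (F :|: [set s; t]); rewrite -/Z => /(congr1 odd).
rewrite (negPf evT) oddD (_ : odd #|F :|: [set s; t]| = odd #|F|).
  by rewrite evF; case: odd.
by rewrite setUC -setUA !cardsU1 in_setU1 !negb_or nst nsF ntF /= negbK.
Qed.

Lemma boundary_ge3 F z : F != set0 -> z \notin F -> z \notin boundary e F -> 3 <= #|boundary e F|.
Proof.
move=> F0 zF zb; have nb s : s \in boundary e F -> s \notin F by case/boundaryP.
have zne s : s \in boundary e F -> z != s by move=> sb; apply: contraNneq zb => ->.
case E : #|boundary e F| => [|[|[|n]]] //.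
- by move/cards0_eq: E => /(conn F0) FT; rewrite FT inE in zF.
- have /cards1P[s Es] : #|boundary e F| == 1 by rewrite E.
  have sb : s \in boundary e F by rewrite Es set11.
  by case: (@no_cut1 F s z) => //; rewrite ?Es ?nb ?zne.
have /cards2P[s [t [nst Es]]] : #|boundary e F| == 2 by rewrite E.
have sb : s \in boundary e F by rewrite Es set21.
have tb : t \in boundary e F by rewrite Es set22.
by case: (@no_cut2 F s t z) => //; rewrite ?Es ?nb ?zne.
Qed.

Definition separated (I : {set T}) (f : T -> {set T}) := forall i j x y,
  i \in I -> j \in I -> i != j -> x \in f i -> y \in f j -> x != y /\ ~~ e x y.

Definition mult (I : {set T}) (f : T -> {set T}) z := #|[set i in I | z \in boundary e (f i)]|.

Lemma mult_le2 I f z : separated I f -> mult I f z <= 2.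
Proof.
move=> sep; rewrite leqNgt; apply/negP => /card_gt2P[i [j [k [[]]]]].
move=> /setIdP[iI /boundaryP[_ [x xi exz]]] /setIdP[jI /boundaryP[_ [y yj eyz]]].
move=> /setIdP[kI /boundaryP[_ [w wk ewz]]] [nij njk nki].
rewrite eq_sym in nki.
have [? ?] := sep _ _ _ _ iI jI nij xi yj.
have [? ?] := sep _ _ _ _ jI kI njk yj wk.
have [? ?] := sep _ _ _ _ iI kI nki xi wk.
by apply: (no_claw claw (x := z) (a := x) (b := y) (c := w)) => //; rewrite e_sym.
Qed.

(** A neighbour [y] of [z] away from all the parts serves as the third leaf, so two parts already
    give a claw at [z]. *)
Lemma mult_le1 I f z y : separated I f -> e z y ->
  (forall i, i \in I -> y \notin f i /\ y \notin boundary e (f i)) -> mult I f z <= 1.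
Proof.
move=> sep ezy ny; rewrite leqNgt; apply/negP => /card_gt1P[i [j []]].
move=> /setIdP[iI /boundaryP[_ [x xi exz]]] /setIdP[jI /boundaryP[_ [w wj ewz]]] nij.
have [? ?] := sep _ _ _ _ iI jI nij xi wj.
have nyx k x' : k \in I -> x' \in f k -> y != x' /\ ~~ e y x'.
  move=> kI xk; have [yf yb] := ny k kI; split; first by apply: contraNneq yf => ->.
  by apply: contra yb => eyx; apply/boundaryP; split=> //; exists x'; rewrite // e_sym.
have [? ?] := nyx i x iI xi; have [? ?] := nyx j w jI wj.
by apply: (no_claw claw (x := z) (a := y) (b := x) (c := w)) => //; rewrite e_sym.
Qed.

Lemma boundary_count (I : {set T}) f S : (forall i, i \in I -> boundary e (f i) \subset S) ->
  (forall i, i \in I -> 3 <= #|boundary e (f i)|) -> 3 * #|I| <= \sum_(z in S) mult I f z.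
Proof.
move=> sub b3; rewrite mulnC -sum_nat_const.
apply: (@leq_trans (\sum_(i in I) #|boundary e (f i)|)); first exact: leq_sum.
rewrite (eq_bigr (fun i => \sum_(z in S) (z \in boundary e (f i)))); last first.
  by move=> i iI; rewrite -card_setI_sum (setIidPr (sub i iI)).
rewrite exchange_big /=; apply: leq_sum => z _.
by rewrite /mult -sum1dep_card -big_mkcondr.
Qed.

End Dense.

(** * Smallest fragments *)

(** Five is four plus one: a petal is bounded by the matched four-set [Y] and by the core vertex at
    which it hangs. *)
Definition fragment (T : finType) (e : rel T) (F : {set T}) : bool :=
  [&& F != set0, #|boundary e F| <= 5 & F :|: boundary e F != [set: T]].

Section MinimalFragment.
Variables (T : finType) (e : rel T).
Hypotheses (e_sym : symmetric e) (e_irr : irreflexive e).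
Hypothesis ext_pm : forall a b c d, e a b -> e c d -> uniq [:: a; b; c; d] ->
  pm e (~: [set a; b; c; d]).
Hypothesis conn : forall F : {set T}, F != set0 -> boundary e F = set0 -> F = [set: T].
Hypothesis claw : clawless e [set: T].
Hypothesis evT : ~~ odd #|T|.
Hypothesis deg6 : forall x, 6 <= #|nbrs e x|.
Implicit Types F C S Q : {set T}.

Lemma fragment_intro F S z : F != set0 -> boundary e F \subset S -> #|S| <= 5 ->
  z \notin F -> z \notin S -> fragment e F.
Proof.
move=> F0 sF S5 zF zS; apply/and3P; split=> //.
  exact: leq_trans (subset_leq_card sF) S5.
apply: contraNneq zS => FT; have : z \in F :|: boundary e F by rewrite FT inE.
by rewrite in_setU (negPf zF); apply: (subsetP sF).
Qed.

Variable O : {set T}.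
Hypotheses (fragO : fragment e O) (minO : forall F, fragment e F -> #|O| <= #|F|).
Local Notation X := (boundary e O).
Local Notation R := (~: (O :|: X)).

Lemma boundaryO_le5 : #|X| <= 5.
Proof. by case/and3P: fragO. Qed.

Lemma part_OXR z : (z \in O) + (z \in X) + (z \in R) = 1.
Proof.
rewrite in_setC in_setU; have [zO|] := boolP (z \in O); last by case: (z \in X).
by rewrite (_ : z \in X = false) //; apply/negP => /boundaryP[]; rewrite zO.
Qed.

Lemma rest_ex : exists r, r \in R.
Proof.
case/and3P: fragO => _ _ ne; apply/set0Pn; apply: contraNneq ne => R0.
by rewrite -[_ :|: _]setCK R0 setC0.
Qed.

Lemma R_notO r : r \in R -> r \notin O.
Proof. by rewrite in_setC in_setU negb_or => /andP[]. Qed.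

Lemma O_R o r : o \in O -> r \in R -> ~~ e o r.
Proof.
move=> oO rR; apply/negP => eor; move: rR; rewrite in_setC in_setU negb_or.
by case/andP=> /negPf rO /negPf rX; case: (boundary_or oO eor); rewrite ?rO ?rX.
Qed.

(** With a smaller boundary, [Q] would be a fragment smaller than [O]: vertices of [R] lie neither
    in [Q] nor in its boundary. *)
Lemma sub_boundary6 Q : Q \subset O -> Q != set0 -> Q != O -> 6 <= #|boundary e Q|.
Proof.
move=> sQO Q0 QO; rewrite ltnNge; apply/negP => b5; case/negP: QO.
have [r rR] := rest_ex.
rewrite eqEcard sQO; apply: minO; apply: (fragment_intro (z := r) Q0 (subxx _) b5).
  by apply: contra (R_notO rR); apply: (subsetP sQO).
apply/negP => /boundaryP[_ [x /(subsetP sQO) xO exr]].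
by have := O_R xO rR; rewrite exr.
Qed.

Lemma region_count (I : {set T}) f Q : separated e I f ->
  (forall i, i \in I -> f i != set0 /\ f i \subset R) ->
  (forall i, i \in I -> boundary e (f i) \subset X :|: Q) ->
  3 * #|I| <= \sum_(z in X) mult e I f z + \sum_(z in Q) mult e I f z.
Proof.
move=> sep fR bf; apply: (@leq_trans (\sum_(z in X :|: Q) mult e I f z)).
  apply: boundary_count => // i iI; have [fi0 fiR] := fR i iI.
  have [o oO] : exists o, o \in O by apply/set0Pn; case/and3P: fragO.
  apply: (boundary_ge3 (z := o) e_sym e_irr ext_pm conn evT deg6 fi0).
    by apply/negP => /(subsetP fiR)/R_notO; rewrite oO.
  apply/negP => /boundaryP[_ [r /(subsetP fiR) rR ero]].
  by have := O_R oO rR; rewrite e_sym ero.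
rewrite ![\sum_(_ in _) _]big_mkcond -big_split /=; apply: leq_sum => z _.
rewrite in_setU; case: (z \in X) => /=; first by rewrite leq_addr.
by case: ifP.
Qed.

(** The third leaf is a neighbour of [z] in [O], which has no neighbour in [R]. *)
Lemma mult_X (I : {set T}) f z : separated e I f ->
  (forall i, i \in I -> f i \subset R) -> z \in X -> mult e I f z <= 1.
Proof.
move=> sep fR /boundaryP[_ [o oO eoz]].
apply: (mult_le1 e_sym claw (y := o) sep) => [|i iI]; first by rewrite e_sym.
split; first by apply: contraL oO => /(subsetP (fR i iI))/R_notO.
apply/negP => /boundaryP[_ [r /(subsetP (fR i iI)) rR ero]].
by have := O_R oO rR; rewrite e_sym ero.
Qed.

Lemma region_bound (I : {set T}) f Q : separated e I f ->
  (forall i, i \in I -> f i != set0 /\ f i \subset R) ->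
  (forall i, i \in I -> boundary e (f i) \subset X :|: Q) ->
  3 * #|I| <= #|X| + 2 * #|Q|.
Proof.
move=> sep fR bf; apply: leq_trans (region_count sep fR bf) _.
rewrite -[#|X|]sum1_card mulnC -sum_nat_const leq_add //; apply: leq_sum => z zX.
  by apply: mult_X => // i /fR[].
exact: mult_le2.
Qed.

(* A separation [(B, Z)] of order five whose separator consists of a matched
   four-set and one vertex [t] outside [R] cannot split [O]: counting forces
   [|R :&: K| = 1], and the mate of the vertex of [R :&: K] centres a claw. *)
Lemma minimal_not_split a b c d t (B : {set T}) x y :
  e a b -> e c d -> uniq [:: a; b; c; d] -> t \notin [set a; b; c; d] -> t \notin R ->
  [disjoint B & t |: [set a; b; c; d]] ->
  boundary e B \subset t |: [set a; b; c; d] ->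
  x \in O -> x \in B -> y \in O -> y \notin B -> y \notin t |: [set a; b; c; d] -> False.
Proof.
move=> eab ecd U tY tR disB; set K := t |: _ => bB xO xB yO yB yK.
pose Z := ~: (B :|: K).
have bZ : boundary e Z \subset K by apply: boundary_compl.
have yZ : y \in Z by rewrite in_setC in_setU negb_or yB.
have BK z : z \in B -> z \notin K by move=> zB; rewrite (disjointFr disB zB).
have BZ z : z \in B -> z \notin Z by move=> zB; rewrite in_setC in_setU zB.
have ZK z : z \in Z -> z \notin K by rewrite in_setC in_setU negb_or => /andP[].
have pBZK z : (z \in B) + (z \in Z) + (z \in K) = 1.
  rewrite /Z in_setC in_setU; have [zB|] := boolP (z \in B); last by case: (z \in K).
  by rewrite (negPf (BK z zB)).
have K5 : #|K| = 5.
  by rewrite cardsU1 tY; have := card_uniqP U; rewrite /= => <-; congr (_ + _); apply: eq_card => z; rewrite !inE -!orbA.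
have ZB z : z \in Z -> z \notin B by apply: contraTN => /BZ.
(* Both sides of the separation are treated alike. [O :&: G] is a proper part of [O], so
   [sub_boundary6] applies to it. If [G] misses [R], comparing the size of [O], which also meets
   [H], with that of the fragment [G] gives the strict inequality. *)
have side (G H : {set T}) g h : boundary e G \subset K -> (forall z, z \in G -> z \notin K) ->
    (forall z, z \in H -> z \notin K) ->
    (forall z, z \in H -> z \notin G) -> g \in O -> g \in G -> h \in O -> h \in H ->
    (forall z, (z \in G) + (z \in H) + (z \in K) = 1) ->
    6 <= #|X :&: G| + #|X :&: K| + #|O :&: K| /\
    (R :&: G = set0 -> #|O :&: K| < #|X :&: G|).
  move=> bG GK HK HG gO gG hO hH pGHK; split.
    apply: leq_trans (@sub_boundary6 (O :&: G) _ _ _) _.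
    - exact: subsetIl.
    - by apply/set0Pn; exists g; rewrite inE gO.
    - by apply/negP => /eqP E; move: hO; rewrite -E inE (negPf (HG h hH)) andbF.
    apply: card_sub3 => z /boundaryP[zOG [w /setIP[wO wG] ewz]].
    rewrite !in_setI.
    case: (boundary_or wO ewz) => [zO|zX]; case: (boundary_or wG ewz) => [zG|/(subsetP bG) zK].
    - by rewrite inE zO zG in zOG.
    - by constructor 3; rewrite zO.
    - by constructor 1; rewrite zX.
    by constructor 2; rewrite zX.
  move=> RG0; have : #|O| <= #|G|.
    apply: minO; apply: (fragment_intro (S := K) (z := h)) => //.
    - by apply/set0Pn; exists g.
    - by rewrite K5.
    - exact: HG.
    exact: HK.
  rewrite (card_partition3 (S := O) (fun z _ => pGHK z)) (card_partition3 (S := G) (fun z _ => part_OXR z)).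
  rewrite [G :&: R]setIC RG0 cards0 [G :&: O]setIC [G :&: X]setIC.
  have : 0 < #|O :&: H| by apply/card_gt0P; exists h; rewrite inE hO.
  card_lia.
have [sB rB] := side B Z x y bB BK ZK ZB xO xB yO yZ pBZK.
have pZBK z : (z \in Z) + (z \in B) + (z \in K) = 1 by rewrite -(pBZK z) [(z \in Z) + _]addnC.
have [sZ rZ] := side Z B y x bZ ZK BK BZ yO yZ xO xB pZBK.
have X5 := boundaryO_le5.
have cX := card_partition3 (S := X) (fun z _ => pBZK z).
have cK := card_partition3 (S := K) (fun z _ => part_OXR z).
rewrite K5 [K :&: O]setIC [K :&: X]setIC [K :&: R]setIC in cK.
(* If [B] missed [R], then [#|O :&: K| < #|X :&: B|], and the bound of six on the side of [Z] would
   exceed [#|X|]. *)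
have nRB : R :&: B != set0 by apply/eqP => /rB; card_lia.
have nRZ : R :&: Z != set0 by apply/eqP => /rZ; card_lia.
have nxy : x != y by apply: contraNneq yB => <-.
pose f i := if i == x then R :&: B else R :&: Z.
have fx : f x = R :&: B by rewrite /f eqxx.
have fy : f y = R :&: Z by rewrite /f eq_sym (negPf nxy).
have sepBZ z w : z \in B -> w \in Z -> z != w /\ ~~ e z w.
  move=> zB wZ; split; first by apply: contraTneq wZ => <-; apply: BZ.
  apply/negP => ezw; case: (boundary_or zB ezw) => [wB|/(subsetP bB)].
    by move: (ZB w wZ); rewrite wB.
  exact/negP/ZK.
have sep : separated e [set x; y] f.
  move=> i j z w /set2P[->|->] /set2P[->|->]; rewrite ?eqxx // => _.
    by rewrite fx fy => /setIP[_ zB] /setIP[_ wZ]; apply: sepBZ.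
  rewrite fx fy => /setIP[_ zZ] /setIP[_ wB]; rewrite eq_sym e_sym; exact: sepBZ.
have := region_bound (Q := R :&: K) sep; rewrite cards2 nxy => H.
have {H} q1 : 6 <= #|X| + 2 * #|R :&: K|.
  apply: H => i /set2P[->|->]; rewrite ?fx ?fy.
  - by rewrite nRB subsetIl.
  - by rewrite nRZ subsetIl.
  - apply: boundary_sub => z w /setIP[zR zB] ezw; rewrite !in_setI in_setU in_setI.
    have wO : w \notin O by apply/negP => wO; have := O_R wO zR; rewrite e_sym ezw.
    have [wX|wX] := boolP (w \in X); first by right.
    have wR : w \in R by rewrite in_setC in_setU negb_or wO wX.
    by rewrite wR; case: (boundary_or zB ezw) => [|/(subsetP bB)] ->; [left|right].
  apply: boundary_sub => z w /setIP[zR zZ] ezw; rewrite !in_setI in_setU in_setI.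
  have wO : w \notin O by apply/negP => wO; have := O_R wO zR; rewrite e_sym ezw.
  have [wX|wX] := boolP (w \in X); first by right.
  have wR : w \in R by rewrite in_setC in_setU negb_or wO wX.
  by rewrite wR; case: (boundary_or zZ ezw) => [|/(subsetP bZ)] ->; [left|right].
(* The two bounds of six add up to [#|X :&: K| + 2 * #|R :&: K| <= 3], while [q1] makes [R :&: K]
   nonempty. *)
have qE : #|R :&: K| = 1 by card_lia.
have cE : #|X :&: K| <= 1 by card_lia.
have [r Er] : exists r, R :&: K = [set r] by apply/cards1P; rewrite qE.
have /setIP[rR rK] : r \in R :&: K by rewrite Er set11.
have [s sK ers] : exists2 s, s \in K & e r s.
  move: rK; rewrite in_setU1 => /orP[/eqP E|]; first by rewrite -E rR in tR.
  rewrite !inE -!orbA => /or4P[]/eqP->; [exists b|exists a|exists d|exists c]; rewrite ?inE ?eqxx ?orbT //; by rewrite e_sym.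
have sX : s \in X.
  apply: contraT => nsX; have sO : s \notin O by apply/negP => sO; have := O_R sO rR; rewrite e_sym ers.
  have : s \in R :&: K by rewrite in_setI sK in_setC in_setU negb_or sO nsX.
  by rewrite Er => /set1P E; move: ers; rewrite E e_irr.
have cs : #|X :&: K| = 1.
  by apply/eqP; rewrite eqn_leq cE; apply/card_gt0P; exists s; rewrite inE sX.
(* If [s] had no neighbour in [O :&: G], the boundary of that set would lie in [X :&: G] and
   [O :&: K], at most five vertices. *)
have touch (G : {set T}) g : boundary e G \subset K -> (forall z, z \in G -> z \notin K) -> g \in O -> g \in G ->
    O :&: G != O -> #|X :&: G| + #|O :&: K| <= 5 -> exists2 o, o \in O :&: G & e s o.
  move=> bG GK gO gG OG le5.
  have := @sub_boundary6 (O :&: G) (subsetIl _ _) _ OG.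
  have -> : O :&: G != set0 by apply/set0Pn; exists g; rewrite inE gO.
  move=> /(_ isT) b6; apply/exists_inP; apply: contraT => /exists_inPn ns.
  suff : #|boundary e (O :&: G)| <= #|X :&: G| + #|O :&: K| by card_lia.
  rewrite -[_ + _]addn0 -(@cards0 T); apply: card_sub3 => z /boundaryP[zOG [w wOG ewz]].
  have /setIP[wO wG] := wOG.
  rewrite !in_setI.
  case: (boundary_or wO ewz) => [zO|zX]; case: (boundary_or wG ewz) => [zG|/(subsetP bG) zK].
  - by rewrite inE zO zG in zOG.
  - by constructor 2; rewrite zO.
  - by constructor 1; rewrite zX.
  have zs : z = s.
    have /eqP/cards1P[s' Es] := cs.
    have : z \in X :&: K by rewrite inE zX.
    have : s \in X :&: K by rewrite inE sX.
    by rewrite Es => /set1P-> /set1P->.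
  by have := ns w wOG; rewrite -zs e_sym ewz.
have [o1 /setIP[o1O o1B] eso1] : exists2 o, o \in O :&: B & e s o.
  apply: (touch B x) => //; last by card_lia.
  by apply/negP => /eqP E; move: yO; rewrite -E inE (negPf yB) andbF.
have [o2 /setIP[o2O o2Z] eso2] : exists2 o, o \in O :&: Z & e s o.
  apply: (touch Z y) => //; last by card_lia.
  by apply/negP => /eqP E; move: xO; rewrite -E inE (negPf (BZ x xB)) andbF.
have [n12 e12] := sepBZ _ _ o1B o2Z.
have nr o : o \in O -> r != o by move=> oO; apply: contraTneq oO => <-; apply: R_notO.
apply: (no_claw claw (x := s) (a := r) (b := o1) (c := o2)) => //; rewrite ?nr //.
- by rewrite e_sym.
- by rewrite e_sym O_R.
by rewrite e_sym O_R.
Qed.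

End MinimalFragment.

(** * Edges inside a smallest fragment *)

Definition edges_forced (T : finType) (e : rel T) : Prop :=
  forall u v, e u v -> exists a b c d W B,
    [/\ e a b, e c d, uniq [:: a; b; c; d],
        u \notin [set a; b; c; d] & v \notin [set a; b; c; d]] /\
    petals e (~: [set a; b; c; d]) u v W B.

Section NoLargeFragment.
Variables (T : finType) (e : rel T).
Hypotheses (e_sym : symmetric e) (e_irr : irreflexive e).
Hypothesis ext_pm : forall a b c d, e a b -> e c d -> uniq [:: a; b; c; d] ->
  pm e (~: [set a; b; c; d]).
Hypothesis conn : forall F : {set T}, F != set0 -> boundary e F = set0 -> F = [set: T].
Hypothesis claw : clawless e [set: T].
Hypothesis evT : ~~ odd #|T|.
Hypothesis deg6 : forall x, 6 <= #|nbrs e x|.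

Section Petals.
Variables (a b c d u v : T) (W : {set T}) (B : T -> {set T}).
Local Notation Y := [set a; b; c; d].
Local Notation core := ([set u; v] :|: W).
Hypotheses (uY : u \notin Y) (vY : v \notin Y) (euv : e u v).
Hypothesis pet : petals e (~: Y) u v W B.

Lemma coreP t : t \in core -> [\/ t = u, t = v | t \in W].
Proof. by case/setUP=> [/set2P[]|]; [constructor 1|constructor 2|constructor 3]. Qed.

Lemma core_u : u \in core. Proof. by rewrite !inE eqxx. Qed.
Lemma core_v : v \in core. Proof. by rewrite !inE eqxx orbT. Qed.
Lemma core_W w : w \in W -> w \in core. Proof. by move=> wW; rewrite !inE wW !orbT. Qed.

Lemma core_notY t : t \in core -> t \notin Y.
Proof. by case/coreP=> [->|->|/(petals_centre pet)[]] //; rewrite in_setC. Qed.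

Lemma W_adj w : w \in W -> e u w /\ e v w.
Proof. by case/(petals_centre pet). Qed.

Lemma u_notW : u \notin W.
Proof. by apply/negP => /W_adj[]; rewrite e_irr. Qed.

Lemma v_notW : v \notin W.
Proof. by apply/negP => /W_adj[]; rewrite e_irr. Qed.

Lemma card_core : #|core| = #|W|.+2.
Proof.
by rewrite -setUA !cardsU1 in_setU1 negb_or u_notW v_notW (rel_neq e_irr euv).
Qed.

Lemma petal_notY t z : t \in core -> z \in B t -> z \notin Y.
Proof. by move=> tc /(petals_sub pet tc)[]; rewrite in_setC. Qed.

Lemma petal_notcore t z : t \in core -> z \in B t -> z \notin core.
Proof. by move=> tc /(petals_sub pet tc)[]. Qed.

Lemma petal_nbr t z y : t \in core -> z \in B t -> e z y ->
  [\/ y \in B t, y = t | y \in Y].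
Proof.
move=> tc zB ezy; have [yY|yY] := boolP (y \in Y); first by constructor 3.
have yH : y \in ~: Y by rewrite in_setC.
by case: (petals_nb pet tc zB yH ezy) => ?; [constructor 1|constructor 2].
Qed.

(** Consequently a vertex outside [Y] with two core neighbours lies in the core itself. *)
Lemma core_petal t s z : t \in core -> s \in core -> z \in B t -> e z s -> s = t.
Proof.
move=> tc sc zB ezs; case: (petal_nbr tc zB ezs) => //.
  by move/(petal_notcore tc); rewrite sc.
by rewrite (negPf (core_notY sc)).
Qed.

Lemma petal_boundary t : t \in core -> boundary e (B t) \subset t |: Y.
Proof.
move=> tc; apply: boundary_sub => z y zB ezy.
by case: (petal_nbr tc zB ezy) => [->|->|yY]; [left|right; rewrite setU11|right; rewrite setU1r].
Qed.

Lemma petal_disjoint t : t \in core -> [disjoint B t & t |: Y].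
Proof.
move=> tc; rewrite disjoints_subset; apply/subsetP => z zB.
rewrite in_setC in_setU1 negb_or (petal_notY tc zB) andbT.
by apply: contraTneq (tc) => <-; apply: petal_notcore tc zB.
Qed.

Lemma petal_cover z : z \notin Y -> [\/ z = u, z = v, z \in W | exists2 t, t \in core & z \in B t].
Proof.
move=> zY; have zH : z \in ~: Y by rewrite in_setC.
by case: (petals_cover pet zH) => [/coreP[]|] ?; [constructor 1|constructor 2|constructor 3|constructor 4].
Qed.

(** A core vertex other than [t]: it witnesses that the separator [t |: Y] of the petal at [t]
    leaves something on the far side. *)
Definition other t := if t == u then v else u.

Lemma other_core t : other t \in core.
Proof. by rewrite /other; case: ifP; rewrite ?core_u ?core_v. Qed.

Lemma other_neq t : other t != t.
Proof.
rewrite /other eq_sym; have [->|//] := eqVneq t u; exact: rel_neq euv.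
Qed.

Lemma other_outside t : t \in core -> other t \notin B t /\ other t \notin t |: Y.
Proof.
move=> tc; split; first by apply/negP => /(petal_notcore tc); rewrite other_core.
by rewrite in_setU1 negb_or other_neq core_notY // other_core.
Qed.

Lemma card_Y4 : uniq [:: a; b; c; d] -> #|Y| = 4.
Proof.
by move=> U; have := card_uniqP U; rewrite /= => <-; apply: eq_card => z; rewrite !inE -!orbA.
Qed.

Lemma petal_fragment t : uniq [:: a; b; c; d] -> t \in core -> B t != set0 -> fragment e (B t).
Proof.
move=> U tc B0; have [oB oK] := other_outside tc.
apply: (fragment_intro B0 (petal_boundary tc) _ oB oK).
by rewrite cardsU1 core_notY // card_Y4.
Qed.

Lemma petal_separated (I : {set T}) (f : T -> {set T}) : I \subset core ->
  (forall t, f t \subset B t) -> separated e I f.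
Proof.
move=> /subsetP sI sf i j x y /sI ic /sI jc nij /(subsetP (sf i)) xB /(subsetP (sf j)) yB; split.
  apply: contraNneq nij => E; rewrite -E in yB; apply/eqP; exact: (petals_disj pet ic jc xB yB).
apply/negP => exy; case: (petal_nbr ic xB exy) => [yB'|E|yY].
- by move: nij; rewrite (petals_disj pet ic jc yB' yB) eqxx.
- by have := petal_notcore jc yB; rewrite E ic.
by have := petal_notY jc yB; rewrite yY.
Qed.

End Petals.

(** If all petals were empty, so would be [W], whose petals have vertices; then [x0] would have at
    most five neighbours, namely [v] and the four removed vertices. *)
Lemma fragment_ex (x0 : T) : edges_forced e -> exists F, fragment e F.
Proof.
move=> bad; have [|v euv _] := @nbr_avoiding _ _ deg6 x0 set0; first by rewrite cards0.
have [a [b [c [d [W [B [[eab ecd U uY vY] pet]]]]]]] := bad _ _ euv.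
have [[t tc B0]|allB] : (exists2 t, t \in [set x0; v] :|: W & B t != set0) \/
    (forall t, t \in [set x0; v] :|: W -> B t = set0).
  case: (boolP [exists t in [set x0; v] :|: W, B t != set0]) => [/exists_inP|/exists_inPn H]; [by left|right].
  by move=> t /H; rewrite negbK => /eqP.
  by exists (B t); exact: (petal_fragment uY vY euv pet U tc B0).
have W0 w : w \notin W.
  apply/negP => wW; have [z] := petals_touch pet wW.
  by rewrite allB ?inE // wW orbT.
have : #|nbrs e x0| <= 5; last by rewrite leqNgt deg6.
apply: (@leq_trans #|v |: [set a; b; c; d]|); last by rewrite cardsU1 card_Y4 //; case: (_ \notin _).
apply/subset_leq_card/subsetP => z; rewrite in_nbrs in_setU1 => exz.
have [//|zY] := boolP (z \in [set a; b; c; d]); first by rewrite orbT.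
rewrite orbF; case: (petal_cover pet zY) => [E|->|zW|[t /allB->]] //; last by rewrite inE.
  by move: exz; rewrite E e_irr.
by have := W0 z; rewrite zW.
Qed.

Variable O : {set T}.
Hypotheses (fragO : fragment e O) (minO : forall F, fragment e F -> #|O| <= #|F|).
Hypothesis bad : edges_forced e.
Local Notation X := (boundary e O).
Local Notation R := (~: (O :|: X)).

(** Petals miss [O], so [O] is covered by [{u, v}], [W] and [Y]. Put [q = #|R :&: Y|] and let [I]
    index the nonempty petals; then [3 * #|I| <= 5 + 2 * q]. If the petals at [u] and [v] are both
    nonempty, [#|I| = #|W| + 2] and the second alternative follows. Otherwise the degree of [u] or
    [v] gives [#|W| >= q + 1], both petals are empty and [{u, v}] is itself a fragment. *)
Lemma fragment_edge u v : u \in O -> v \in O -> e u v ->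
  #|O| <= 2 \/ #|X :&: (nbrs e u :&: nbrs e v)| + #|O| <= 5.
Proof.
move=> uO vO euv.
have [a [b [c [d [W [B [[eab ecd U uY vY] pet]]]]]]] := bad euv.
pose Y := [set a; b; c; d]; pose core := [set u; v] :|: W.
have uc : u \in core := core_u u v W.
have vc : v \in core := core_v u v W.
have coreE t := @coreP u v W t.
have nuv := rel_neq e_irr euv.
have core_notR t : t \in core -> t \notin R.
  case/coreE=> [->|->|/(W_adj pet)[eut _]]; [by apply/negP => /R_notO; rewrite uO|by apply/negP => /R_notO; rewrite vO|].
  by apply/negP => tR; have := O_R uO tR; rewrite eut.
have BO t z : t \in core -> z \in B t -> z \notin O.
  move=> tc zB; apply/negP => zO; have [oB oK] := other_outside uY vY euv pet tc.
  have oO : other u v t \in O by rewrite /other; case: ifP.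
  apply: (minimal_not_split e_sym e_irr ext_pm conn claw evT deg6 fragO minO eab ecd U _ _ _ _ zO zB oO oB oK).
  - exact: (core_notY uY vY pet tc).
  - exact: core_notR.
  - exact: (petal_disjoint pet tc).
  exact: (petal_boundary pet tc).
have inR z : z \notin O -> z \notin X -> z \in R by move=> h1 h2; rewrite in_setC in_setU negb_or h1.
have Y4 : #|Y| = 4 := card_Y4 U.
have cY : #|Y :\: R| + #|R :&: Y| = 4 by rewrite -Y4 -(cardsID R Y) addnC [Y :&: R]setIC.
have cY3 := card_partition3 (S := Y) (fun z _ => part_OXR e O z).
rewrite Y4 [Y :&: O]setIC [Y :&: X]setIC [Y :&: R]setIC in cY3.
have degs s : s \in [set u; v] -> 6 <= 1 + #|W| + #|Y :\: R| + #|X :&: B s|.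
  move=> suv; have sc : s \in core by rewrite inE suv.
  have sO : s \in O by case/set2P: suv => ->.
  apply: leq_trans (deg6 s) _.
  have -> : 1 + #|W| = #|other u v s |: W|.
    by rewrite cardsU1 /other; case: ifP => _; rewrite ?(u_notW pet) ?(v_notW pet).
  apply: card_sub3 => z; rewrite in_nbrs => esz.
  have [zY|zY] := boolP (z \in Y).
    by constructor 2; rewrite in_setD zY andbT; apply/negP => zR; have := O_R sO zR; rewrite esz.
  have nsz := rel_neq e_irr esz.
  case: (petal_cover pet zY) => [E|E|zW|[t tc zB]].
  - constructor 1; rewrite in_setU1 E /other; case/set2P: suv => Es; rewrite Es; first by rewrite Es E eqxx in nsz.
    by rewrite [v == u]eq_sym (negPf nuv) eqxx.
  - constructor 1; rewrite in_setU1 E /other; case/set2P: suv => Es; rewrite Es ?eqxx //; by rewrite Es E eqxx in nsz.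
  - by constructor 1; rewrite in_setU1 zW orbT.
  have Et : s = t by apply: (core_petal uY vY pet tc sc zB); rewrite e_sym.
  subst t; constructor 3; rewrite in_setI zB andbT.
  apply: contraT => zX; have zR := inR z (BO s z sc zB) zX.
  by have := O_R sO zR; rewrite esz.
have cW : #|W| = #|O :&: W| + #|X :&: W|.
  rewrite (card_partition3 (S := W) (fun z _ => part_OXR e O z)) [W :&: O]setIC [W :&: X]setIC.
  rewrite (_ : W :&: R = set0) ?cards0 ?addn0 //.
  apply/setP => z; rewrite in_setI [RHS]inE; apply/negP => /andP[zW]; apply/negP.
  by apply: core_notR; apply: core_W.
have cO : #|O| = 2 + #|O :&: Y| + #|O :&: W|.
  rewrite (card_partition3 (A := [set u; v]) (B := Y) (C := W)).
    rewrite (setIidPr _) ?cards2 ?nuv //; by apply/subsetP => z /set2P[]->.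
  move=> z zO; have [zY|zY] := boolP (z \in Y).
    have zc : z \notin core by apply: contraL zY => zc; apply: (core_notY uY vY pet zc).
    have /norP[/negPf-> /negPf-> //] : ~~ ((z \in [set u; v]) || (z \in W)) by rewrite -in_setU.
  case: (petal_cover pet zY) => [->|->|zW|[t tc zB]].
  - by rewrite set21 (negPf (u_notW pet)).
  - by rewrite set22 (negPf (v_notW pet)).
  - rewrite zW; have -> : z \in [set u; v] = false; last by [].
    apply/negP => /set2P[] E; rewrite E in zW; first by rewrite (negPf (u_notW pet)) in zW.
    by rewrite (negPf (v_notW pet)) in zW.
  by have := BO t z tc zB; rewrite zO.
have X5 : #|X| <= 5 by apply: boundaryO_le5.
have cX s t : s \in core -> t \in core -> s != t ->
    #|X :&: B s| + #|X :&: B t| + #|X :&: Y| + #|X :&: W| <= #|X|.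
  move=> sc tc nst; rewrite !card_setI_sum -!big_split -sum1_card; apply: leq_sum => z _ /=.
  have [zs|zs] := boolP (z \in B s).
    have -> : z \in B t = false by apply: contraNF nst => zt; apply/eqP; apply: (petals_disj pet sc tc zs zt).
    rewrite (negPf (petal_notY pet sc zs)); have := petal_notcore pet sc zs.
    by rewrite in_setU negb_or => /andP[_ /negPf->].
  have [zt|zt] := boolP (z \in B t).
    rewrite (negPf (petal_notY pet tc zt)); have := petal_notcore pet tc zt.
    by rewrite in_setU negb_or => /andP[_ /negPf->].
  have [zW|] := boolP (z \in W); last by case: (z \in Y).
  by rewrite (negPf (core_notY uY vY pet (core_W u v zW))).
(* A nonempty petal missing [R] would lie in [X], whence [#|O| <= #|X :&: B t|]; the degree of an
   end of [uv] other than [t] then makes [X] larger than five. *)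
have RB t : t \in core -> B t != set0 -> R :&: B t != set0.
  move=> tc B0; apply/eqP => RB0.
  have := minO (petal_fragment uY vY euv pet U tc B0).
  rewrite (card_partition3 (S := B t) (fun z _ => part_OXR e O z)).
  rewrite [B t :&: O]setIC [B t :&: X]setIC [B t :&: R]setIC RB0 cards0.
  have -> : O :&: B t = set0.
    apply/setP => z; rewrite in_setI [RHS]inE; apply/negP => /andP[zO zB].
    by have := BO t z tc zB; rewrite zO.
  rewrite cards0.
  have ouv : other u v t \in [set u; v] by rewrite /other; case: ifP; rewrite ?set21 ?set22.
  have := cX _ t (other_core u v W t) tc (other_neq euv t); have := degs _ ouv.
  card_lia.
pose I := [set t in core | B t != set0].
have sI : I \subset core by apply/subsetP => t /setIdP[].
have I3 : 3 * #|I| <= 5 + 2 * #|R :&: Y|.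
  apply: (@leq_trans (#|X| + 2 * #|R :&: Y|)); last by rewrite leq_add2r.
  apply: (region_bound (f := fun t => R :&: B t) e_sym e_irr ext_pm conn claw evT deg6 fragO).
  - by apply: (petal_separated pet sI) => t; apply: subsetIr.
  - by move=> t /setIdP[tc B0]; split; [apply: RB|apply: subsetIl].
  move=> t /setIdP[tc B0]; apply: boundary_sub => z w /setIP[zR zB] ezw.
  have wO : w \notin O by apply/negP => wO; have := O_R wO zR; rewrite e_sym ezw.
  have [wX|wX] := boolP (w \in X); first by right; rewrite in_setU wX.
  have wR := inR w wO wX; rewrite !in_setI in_setU in_setI wR /=.
  case: (petal_nbr pet tc zB ezw) => [->|E|->]; [by left| |by right; rewrite orbT].
  by have := core_notR t tc; rewrite -E wR.
have WI w : w \in W -> w \in I.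
  move=> wW; rewrite inE core_W //=; apply/set0Pn.
  by have [z zB _] := petals_touch pet wW; exists z.
have [Bs|] := boolP [exists s in [set u; v], B s == set0]; last first.
  rewrite negb_exists => /forallP nB; right.
  have Bn s : s \in [set u; v] -> B s != set0 by move=> suv; have := nB s; rewrite suv.
  have EI : I = core.
    apply/setP => t; rewrite inE andb_idr // => /coreE[->|->|/WI/setIdP[]//].
      by apply: Bn; rewrite set21.
    by apply: Bn; rewrite set22.
  have dI : #|I| = #|W|.+2 by rewrite EI; apply: (card_core euv pet).
  have : #|X :&: (nbrs e u :&: nbrs e v)| <= #|X :&: Y| + #|X :&: W| + #|@set0 T|.
    apply: card_sub3 => z /setIP[zX /setIP[]]; rewrite !in_nbrs => euz evz.
    have [zY|zY] := boolP (z \in Y); first by constructor 1; rewrite inE zX.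
    case: (petal_cover pet zY) => [E|E|zW|[t tc zB]].
    - by move: euz; rewrite E e_irr.
    - by move: evz; rewrite E e_irr.
    - by constructor 2; rewrite inE zX.
    rewrite e_sym in euz; rewrite e_sym in evz.
    have Eu := core_petal uY vY pet tc uc zB euz.
    have Ev := core_petal uY vY pet tc vc zB evz.
    by move: nuv; rewrite Eu Ev eqxx.
  rewrite cards0; card_lia.
left; case/exists_inP: Bs => s suv /eqP Bs.
have sc : s \in core by rewrite inE suv.
have ds := degs s suv; rewrite Bs setI0 cards0 in ds.
have WsubI : #|W| <= #|I| by apply: subset_leq_card; apply/subsetP.
have ouv : other u v s \in [set u; v] by rewrite /other; case: ifP; rewrite ?set21 ?set22.
(* Otherwise [#|I| >= #|W| + 1 >= #|R :&: Y| + 2], too many for [I3]. *)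
have Bo : B (other u v s) = set0.
  apply/eqP; apply: contraT => B0.
  have : #|other u v s |: W| <= #|I|.
    apply: subset_leq_card; apply/subsetP => z /setU1P[->|/WI//].
    by rewrite inE other_core.
  rewrite cardsU1 (_ : other u v s \notin W); last first.
    by rewrite /other; case: ifP => _; rewrite ?(u_notW pet) ?(v_notW pet).
  card_lia.
have Bu : B u = set0.
  by move: Bs Bo; case/set2P: suv => -> //; rewrite /other eq_sym (negPf nuv).
have Bv : B v = set0.
  by move: Bs Bo; case/set2P: suv => -> //; rewrite /other eqxx.
have <- : #|[set u; v]| = 2 by rewrite cards2 nuv.
apply: minO.
have [w wW] : exists w, w \in W by apply/card_gt0P; card_lia.
have [z zB _] := petals_touch pet wW.
have zc := petal_notcore pet (core_W u v wW) zB.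
move: (zc); rewrite in_setU negb_or => /andP[zuv zW].
(* With both petals empty, the neighbours of [{u, v}] lie in [W] and [Y :\: R], at most five
   vertices by [I3]; a vertex of a petal at [W] is left over. *)
apply: (fragment_intro (S := W :|: (Y :\: R)) (z := z)) => //.
- by apply/set0Pn; exists u; rewrite set21.
- apply: boundary_sub => x y xuv exy.
  have xO : x \in O by case/set2P: xuv => ->.
  have xc : x \in core by rewrite inE xuv.
  have Bx : B x = set0 by case/set2P: xuv => ->.
  rewrite [y \in W :|: _]in_setU [y \in Y :\: _]in_setD; have [yY|yY] := boolP (y \in Y).
    right; rewrite andbT; apply/orP; right.
    by apply/negP => yR; have := O_R xO yR; rewrite exy.
  case: (petal_cover pet yY) => [->|->|->|[t tc yB]]; [by left; rewrite set21|by left; rewrite set22|by right|].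
  rewrite e_sym in exy; have E := core_petal uY vY pet tc xc yB exy.
  by move: yB; rewrite -E Bx inE.
- by apply: leq_trans (leq_card_setU _ _) _; card_lia.
by rewrite in_setU (negPf zW) in_setD (negPf (petal_notY pet (core_W u v wW) zB)) andbF.
Qed.

End NoLargeFragment.

(** * Twins *)

Section Twins.
Variables (T : finType) (e : rel T).
Hypotheses (e_sym : symmetric e) (e_irr : irreflexive e).
Hypothesis ext_pm : forall a b c d, e a b -> e c d -> uniq [:: a; b; c; d] ->
  pm e (~: [set a; b; c; d]).
Hypothesis conn : forall F : {set T}, F != set0 -> boundary e F = set0 -> F = [set: T].
Hypothesis claw : clawless e [set: T].
Hypothesis evT : ~~ odd #|T|.
Hypothesis deg6 : forall x, 6 <= #|nbrs e x|.
Hypothesis bad : edges_forced e.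

(** If [O] has more than two vertices, each of them has at least [7 - #|O|] neighbours in [X], while
    adjacent ones share at most [5 - #|O|]; a triangle in [O] then overfills [X]. *)
Lemma minimal_fragment_pair (O : {set T}) : fragment e O ->
  (forall F, fragment e F -> #|O| <= #|F|) -> exists u v, O = [set u; v] /\ e u v.
Proof.
move=> fragO minO; pose X := boundary e O.
have X5 : #|X| <= 5 := boundaryO_le5 fragO.
have split_nbrs u : u \in O -> 6 <= #|X :&: nbrs e u| + #|O :&: nbrs e u|.
  move=> uO; apply: leq_trans (deg6 u) _.
  rewrite -[_ + _]addn0 -(@cards0 T); apply: card_sub3 => z; rewrite !in_setI in_nbrs => euz.
  rewrite euz !andbT.
  by case: (boundary_or uO euz) => ->; [constructor 2|constructor 1].
have subX u : #|X :&: nbrs e u| <= #|X| by apply/subset_leq_card/subsetIl.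
have [u uO] : exists u, u \in O by apply/set0Pn; case/and3P: fragO.
have [v /setIP[vO]] : exists v, v \in O :&: nbrs e u.
  by apply/card_gt0P; have := split_nbrs u uO; have := subX u; card_lia.
rewrite in_nbrs => euv.
have nuv := rel_neq e_irr euv.
have sub2 : [set u; v] \subset O by apply/subsetP => z /set2P[->|->].
have [O2|O3] := leqP #|O| 2.
  exists u, v; split=> //; apply/esym/eqP; rewrite eqEcard sub2 cards2 nuv.
  exact: O2.
exfalso.
have edge s t : s \in O -> t \in O -> e s t -> #|X :&: (nbrs e s :&: nbrs e t)| + #|O| <= 5.
  move=> sO tO est; case: (fragment_edge e_sym e_irr ext_pm conn claw evT deg6 fragO minO bad sO tO est) => // O2.
  by move: O3; rewrite ltnNge O2.
have degO s : s \in O -> #|O :&: nbrs e s| < #|O|.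
  move=> sO; apply: proper_card; apply/properP; split; first exact: subsetIl.
  by exists s; rewrite // inE sO in_nbrs e_irr.
have incl2 (S : {set T}) s t : #|S :&: nbrs e s| + #|S :&: nbrs e t| <= #|S| + #|S :&: (nbrs e s :&: nbrs e t)|.
  rewrite !card_setI_sum -sum1_card -!big_split; apply: leq_sum => z _ /=.
  by rewrite !inE; case: (e s z); case: (e t z).
have incl3 s t w : #|X :&: nbrs e s| + #|X :&: nbrs e t| + #|X :&: nbrs e w| <=
    #|X| + #|X :&: (nbrs e s :&: nbrs e t)| + #|X :&: (nbrs e s :&: nbrs e w)| + #|X :&: (nbrs e t :&: nbrs e w)|.
  rewrite !card_setI_sum -sum1_card -!big_split; apply: leq_sum => z _ /=.
  by rewrite !inE; case: (e s z); case: (e t z); case: (e w z).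
(* The two neighbourhoods have at least twelve elements in all; [#|X| <= 5] and the bound [edge]
   absorb only ten. *)
have [w /setIP[wO /setIP[]]] : exists w, w \in O :&: (nbrs e u :&: nbrs e v).
  apply/card_gt0P; have := edge u v uO vO euv; have := incl2 O u v; have := incl2 X u v.
  have := split_nbrs u uO; have := split_nbrs v vO; card_lia.
rewrite !in_nbrs => euw evw.
(* [3 * (7 - |O|) <= 5 + 3 * (5 - |O|)] is absurd. *)
have := incl3 u v w; have := edge u v uO vO euv; have := edge u w uO wO euw; have := edge v w vO wO evw.
have := split_nbrs u uO; have := split_nbrs v vO; have := split_nbrs w wO.
have := degO u uO; have := degO v vO; have := degO w wO; card_lia.
Qed.

(** For a neighbour [f] of [s] in [F], the disjoint edges [pq] and [fs] would cut off the odd set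
    [F - f]. *)
Lemma no_even_cut3 (F : {set T}) p q s : ~~ odd #|F| -> 3 <= #|boundary e F| ->
  boundary e F \subset [set p; q; s] -> e p q -> False.
Proof.
move=> evF b3 sub epq.
have c3 : #|[set p; q; s]| <= 3.
  by rewrite setUC cardsU1 cards2; case: (_ \notin _); case: (_ != _).
have Eb : boundary e F = [set p; q; s] by apply/eqP; rewrite eqEcard sub (leq_trans c3).
have npq := rel_neq e_irr epq.
have inb z : z \in [set p; q; s] -> z \notin F by rewrite -Eb => /boundaryP[].
have pF : p \notin F by apply: inb; rewrite !inE eqxx.
have qF : q \notin F by apply: inb; rewrite !inE eqxx orbT.
have sF : s \notin F by apply: inb; rewrite !inE eqxx orbT.
have sb : s \in boundary e F by rewrite Eb !inE eqxx orbT.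
have [_ [f fF efs]] := boundaryP _ _ _ sb.
have spq : s \notin [set p; q].
  apply: contraTN b3 => spq; rewrite -ltnNge Eb setUC.
  by rewrite (setUidPr _) ?sub1set // cards2 npq.
have nfp : f != p by apply: contraNneq pF => <-.
have nfq : f != q by apply: contraNneq qF => <-.
have nfs : f != s by apply: contraNneq sF => <-.
have U : uniq [:: p; q; f; s] by neq.
have := ext2 (C := F :\ f) e_irr ext_pm epq efs U.
rewrite odd_cardsDS ?sub1set // cards1 addbT evF => H; apply/negP: isT; apply: H.
  rewrite disjoints_subset; apply/subsetP => z /setD1P[zf zF]; rewrite in_setC.
  have zp : z != p by apply: contraNneq pF => <-.
  have zq : z != q by apply: contraNneq qF => <-.
  have zs : z != s by apply: contraNneq sF => <-.
  by neq.
apply: boundary_sub => y z /setD1P[_ yF] eyz.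
have [->|zf] := eqVneq z f; first by right; rewrite !inE eqxx !orbT.
rewrite in_setD1 zf; case: (boundary_or yF eyz) => [|zb]; [by left|right].
by move: zb; rewrite Eb !inE => /orP[/orP[]|] ->; rewrite ?orbT.
Qed.

Variables u v : T.
Hypothesis euv : e u v.
Local Notation O := [set u; v].
Local Notation X := (boundary e O).
Local Notation R := (~: (O :|: X)).
Hypothesis fragO : fragment e O.

Let nuv : u != v := rel_neq e_irr euv.
Let uO : u \in O := set21 u v.
Let vO : v \in O := set22 u v.

(** Degree at least six leaves [u] and [v], apart from each other, at least five neighbours in [X],
    which has at most five vertices. *)
Lemma twin_boundary5 : #|X| = 5 /\ forall x, x \in X -> e u x /\ e v x.
Proof.
have X5 := boundaryO_le5 fragO.
have sub s t : O = [set s; t] -> e s t -> nbrs e s \subset t |: X.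
  move=> EO est; apply/subsetP => z; rewrite in_nbrs in_setU1 => esz.
  have sO : s \in O by rewrite EO set21.
  case: (boundary_or sO esz) => [|->]; last by rewrite orbT.
  rewrite EO => /set2P[] E; last by rewrite E eqxx.
  by move: esz; rewrite E e_irr.
have full s t : O = [set s; t] -> e s t -> nbrs e s = t |: X /\ 5 <= #|X|.
  move=> EO est; have sst := sub s t EO est.
  have : #|t |: X| <= 1 + #|X| by rewrite cardsU1; case: (_ \notin _).
  have := deg6 s; have := subset_leq_card sst => h1 h2 h3.
  split; last by move: X5 h1 h2 h3; card_lia.
  apply/eqP; rewrite eqEcard sst; move: X5 h1 h2 h3; card_lia.
have evu : e v u by rewrite e_sym.
have [Nu X5'] := full u v erefl euv.
have [Nv _] := full v u (setUC _ _) evu.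
split; first by apply/eqP; rewrite eqn_leq X5.
by move=> x xX; rewrite -!in_nbrs Nu Nv !in_setU1 xX !orbT.
Qed.

Lemma twin_nbr s z : s \in O -> e s z -> z \in O \/ z \in X.
Proof. exact: boundary_or. Qed.

Lemma X_notO x : x \in X -> x \notin O.
Proof. by case/boundaryP. Qed.

Definition nonnbrs x := (X :\ x) :\: nbrs e x.

Lemma in_nonnbrs x z : (z \in nonnbrs x) = [&& z \in X, z != x & ~~ e x z].
Proof. by rewrite in_setD in_setD1 in_nbrs andbC andbA [_ && (z \in X)]andbC -andbA. Qed.

(** Three pairwise non-adjacent vertices of [X] would form a claw at [u]. *)
Lemma nonnbrs_adj x y z : y \in nonnbrs x -> z \in nonnbrs x -> x \in X -> y != z -> e y z.
Proof.
rewrite !in_nonnbrs => /and3P[yX yx xy] /and3P[zX zx xz] xX nyz; apply: contraT => nyz'.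
have adj t : t \in X -> e u t by case/twin_boundary5.2.
by case: (no_claw claw (adj x xX) (adj y yX) (adj z zX)); rewrite // eq_sym.
Qed.

(** * Counting for an edge from a twin to the boundary *)

Section TwinEdge.
Variables (v' y1 y2 x : T) (W : {set T}) (B : T -> {set T}).
Local Notation Y := [set v; v'; y1; y2].
Local Notation core := ([set u; x] :|: W).
Hypotheses (xX : x \in X) (evv' : e v v') (ey12 : e y1 y2) (U : uniq [:: v; v'; y1; y2]).
Hypotheses (uY : u \notin Y) (xY : x \notin Y) (pet : petals e (~: Y) u x W B).

Let eux : e u x := (twin_boundary5.2 x xX).1.

Lemma twin_petal_notO t z : t \in core -> z \in B t -> z \notin O.
Proof.
move=> tc zB; apply/negP => /set2P[] E.
  by have := petal_notcore pet tc zB; rewrite E core_u.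
by have := petal_notY pet tc zB; rewrite E !inE eqxx.
Qed.

(** A petal vertex in [X] is adjacent to [u], so its petal is the one at [u]. *)
Lemma twin_petal_R t z : t \in core -> t != u -> z \in B t -> z \in R.
Proof.
move=> tc tu zB; rewrite in_setC in_setU negb_or (twin_petal_notO tc zB) /=.
apply/negP => /twin_boundary5.2[euz _]; case/negP: tu; rewrite e_sym in euz.
by rewrite (core_petal uY xY pet tc (core_u u x W) zB euz).
Qed.

Lemma twin_W_X w : w \in W -> w \in X.
Proof.
move=> wW; have [euw _] := W_adj pet wW.
case: (twin_nbr uO euw) => // /set2P[] E; first by move: euw; rewrite E e_irr.
have : w \notin Y := core_notY uY xY pet (core_W u x wW).
by rewrite E !inE eqxx.
Qed.

Lemma twin_v'_X : v' \in X.
Proof.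
case: (twin_nbr vO evv') => // /set2P[] E; first by move: uY; rewrite -E !inE eqxx orbT.
by move: evv'; rewrite E e_irr.
Qed.

(** [Y] meets [O] only in [v], and the five vertices of [X] are those of [X :&: Y], of [x |: W] and
    of [X :&: B u]; eliminating [#|X :&: Y|] gives the second equation. *)
Lemma twin_cards : #|X :&: Y| + #|R :&: Y| = 3 /\
  #|W| + #|X :&: B u| = 1 + #|R :&: Y|.
Proof.
have Y4 := card_Y4 U.
have OY : O :&: Y = [set v].
  apply/setP => z; rewrite in_setI in_set1; apply/andP/eqP => [[/set2P[]-> //]|->].
    by rewrite (negPf uY).
  by rewrite vO !inE eqxx.
have h1 := card_partition3 (S := Y) (fun z _ => part_OXR e O z).
rewrite Y4 [Y :&: O]setIC OY cards1 [Y :&: X]setIC [Y :&: R]setIC in h1.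
have h2 : #|X| = #|X :&: Y| + #|X :&: (x |: W)| + #|X :&: B u|.
  apply: card_partition3 => z zX; have [zY|zY] := boolP (z \in Y).
    have -> : z \in x |: W = false.
      apply/negP => /setU1P[E|zW]; first by move: xY; rewrite -E zY.
      by have := core_notY uY xY pet (core_W u x zW); rewrite zY.
    by have -> : z \in B u = false by apply/negP => /(petal_notY pet (core_u u x W)); rewrite zY.
  have nB s : s \in core -> s \in B u = false.
    by move=> sc; apply/negP => /(petal_notcore pet (core_u u x W)); rewrite sc.
  case: (petal_cover pet zY) => [E|->|zW|[t tc zB]].
  - by move: (X_notO zX); rewrite E uO.
  - by rewrite setU11 nB ?core_v.
  - by rewrite setU1r // nB ?core_W.
  have Et : t = u.
    apply/eqP; apply: contraT => tu; have := twin_petal_R tc tu zB.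
    by rewrite in_setC in_setU zX orbT.
  rewrite -Et zB; have := petal_notcore pet tc zB.
  by rewrite -setUA in_setU1 negb_or => /andP[_ /negPf->].
have h3 : X :&: (x |: W) = x |: W.
  by apply/setIidPr/subsetP => z /setU1P[->//|/twin_W_X].
rewrite h3 cardsU1 (v_notW e_irr pet) twin_boundary5.1 in h2.
move: h1 h2; card_lia.
Qed.

Lemma petal_u_nonnbrs : X :&: B u \subset nonnbrs x.
Proof.
apply/subsetP => z /setIP[zX zB]; rewrite in_nonnbrs zX /=.
have uc := core_u u x W; have xc := core_v u x W.
apply/andP; split; first by apply/eqP => E; have := petal_notcore pet uc zB; rewrite E xc.
apply/negP => exz; rewrite e_sym in exz.
have E := core_petal uY xY pet uc xc zB exz.
by move: eux; rewrite E e_irr.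
Qed.

Lemma odd_petal_u : odd #|R :&: B u| = odd #|X :&: B u|.
Proof.
have := petals_even pet (set21 u x).
rewrite (card_partition3 (S := B u) (fun z _ => part_OXR e O z)).
have -> : B u :&: O = set0.
  apply/setP => z; rewrite in_setI [RHS]inE; apply/negP => /andP[zB zO].
  by have := twin_petal_notO (core_u u x W) zB; rewrite zO.
rewrite cards0 add0n [B u :&: X]setIC [B u :&: R]setIC oddD.
by case: odd; case: odd.
Qed.

Lemma twin_region_boundary t : t \in core -> boundary e (R :&: B t) \subset X :|: (R :&: Y).
Proof.
move=> tc; apply: boundary_sub => z w /setIP[zR zB] ezw.
have wO : w \notin O by apply/negP => wO; have := O_R wO zR; rewrite e_sym ezw.
have [wX|wX] := boolP (w \in X); first by right; rewrite in_setU wX.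
have wR : w \in R by rewrite in_setC in_setU negb_or wO.
rewrite !in_setI in_setU in_setI wR /=.
case: (petal_nbr pet tc zB ezw) => [->|E|->]; [by left| |by right; rewrite orbT].
case/coreP: tc => Et; move: wR; rewrite E ?Et.
- by move/R_notO; rewrite uO.
- by rewrite in_setC in_setU xX orbT.
by rewrite in_setC in_setU (twin_W_X Et) orbT.
Qed.

(** If [X :&: B u] had at most one vertex, more than [#|R :&: Y|] petals besides that of [x] would
    meet [R]. A nonempty petal at [x] adds one more, too many for [region_bound]. If it is empty,
    [x] borders no part and [r] at most one, which tightens the count enough. *)
Lemma twin_nonnbrs_ge2 r : r \in R -> e x r -> 2 <= #|X :&: B u|.
Proof.
move=> rR exr; rewrite ltnNge; apply/negP => a1.
have [cY dW] := twin_cards.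
pose I := [set t in core | R :&: B t != set0].
pose f t := R :&: B t.
have sI : I \subset core by apply/subsetP => t /setIdP[].
have sep : separated e I f by apply: (petal_separated pet sI) => t; apply: subsetIr.
have fR t : t \in I -> f t != set0 /\ f t \subset R.
  by case/setIdP=> _ n0; split=> //; apply: subsetIl.
have fb t : t \in I -> boundary e (f t) \subset X :|: (R :&: Y).
  by case/setIdP=> tc _; apply: twin_region_boundary.
have WI w : w \in W -> w \in I.
  move=> wW; rewrite inE core_W //=; apply/set0Pn; have [z zB _] := petals_touch pet wW.
  exists z; rewrite inE zB andbT; apply: (twin_petal_R (core_W u x wW)) => //.
  by apply: contraTneq wW => ->; apply: (u_notW e_irr pet).
(* If [X :&: B u] is a single vertex, [R :&: B u] is odd, so the petal at [u] provides an extra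
   part. *)
have WsubI : #|W| + (#|X :&: B u| == 1) <= #|I :\ x|.
  have xW : x \notin W := v_notW e_irr pet.
  have sW : W \subset I :\ x.
    by apply/subsetP => w wW; rewrite in_setD1 WI // andbT; apply: contraNneq xW => <-.
  have [a_1|_] := eqVneq #|X :&: B u| 1; last by rewrite addn0 subset_leq_card.
  have uI : u \in I.
    rewrite inE core_u /=; apply/set0Pn/card_gt0P.
    by have := odd_petal_u; rewrite a_1; case: #|_|.
  have -> : #|W| + true = #|u |: W| by rewrite cardsU1 (u_notW e_irr pet) addnC.
  apply/subset_leq_card/subsetP => w /setU1P[->|]; last exact: (subsetP sW).
  by rewrite in_setD1 uI andbT; apply: (rel_neq e_irr).
have xc : x \in core := core_v u x W.
have nxu : x != u by rewrite eq_sym; apply: (rel_neq e_irr).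
have bnd : #|R :&: Y| < #|I :\ x|.
  by move: WsubI a1 dW; case: #|X :&: B u| => [|[|n]] //=; card_lia.
have [Bx|Bx] := eqVneq (B x) set0; last first.
  have xI : x \in I.
    rewrite inE xc /=; have [z zB] := set0Pn _ Bx; apply/set0Pn; exists z.
    by rewrite inE zB andbT; apply: (twin_petal_R xc nxu zB).
  have := region_bound e_sym e_irr ext_pm conn claw evT deg6 fragO sep fR fb.
  have := cardsD1 x I; rewrite xI twin_boundary5.1 /=.
  move: bnd; card_lia.
have rY : r \in Y.
  apply: contraT => rY; case: (petal_cover pet rY) => [E|E|rW|[t tc rB]].
  - by have := R_notO rR; rewrite E uO.
  - by move: exr; rewrite E e_irr.
  - by move: rR; rewrite in_setC in_setU (twin_W_X rW) orbT.
  rewrite e_sym in exr; have E := core_petal uY xY pet tc xc rB exr.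
  by move: rB; rewrite -E Bx inE.
have nx t : t \in I -> x \notin f t /\ x \notin boundary e (f t).
  case/setIdP=> tc _; split.
    by rewrite inE negb_and in_setC in_setU xX orbT.
  apply/negP => /boundaryP[_ [z /setIP[_ zB] ezx]].
  have E := core_petal uY xY pet tc xc zB ezx.
  by move: zB; rewrite -E Bx inE.
have rQ : r \in R :&: Y by rewrite inE rR.
have erx : e r x by rewrite e_sym.
have m1 : mult e I f r <= 1 := mult_le1 e_sym claw sep erx nx.
have mx : mult e I f x = 0.
  apply/eqP; rewrite cards_eq0; apply/eqP/setP => t; rewrite [RHS]inE.
  by apply/negP => /setIdP[/nx[_ /negP]].
have sX : \sum_(z in X) mult e I f z <= 4.
  rewrite (bigD1 x) //= mx add0n.
  have -> : 4 = \sum_(z in X | z != x) 1.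
    by have := twin_boundary5.1; rewrite -sum1_card (bigD1 x) //= => -[<-].
  by apply: leq_sum => z /andP[zX _]; apply: (mult_X (O := O) e_sym claw sep) => // i /fR[].
have sQ : \sum_(z in R :&: Y) mult e I f z + 1 <= 2 * #|R :&: Y|.
  rewrite mulnC -sum_nat_const (bigD1 r rQ) [X in _ <= X](bigD1 r rQ) /=.
  rewrite addn1; apply: (leq_add m1); apply: leq_sum => z _; exact: mult_le2.
(* For [q = #|R :&: Y| > 0] the count reads [3 * (q + 1) <= 4 + (2 * q - 1)], which is
   impossible. *)
have := region_count e_sym e_irr ext_pm conn evT deg6 fragO sep fR fb.
have : #|I :\ x| <= #|I| by apply/subset_leq_card/subsetDl.
have : 0 < #|R :&: Y| by apply/card_gt0P; exists r.
move: bnd sX sQ; card_lia.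
Qed.

(* The odd petal of [w] is cut off by [w], [v'], [y1] and [y2], so [w] and [v']
   are not adjacent; but then a claw at [u] makes [v'] miss only [w]. *)
Lemma twin_two (w : T) : #|R :&: Y| = 2 -> W = [set w] -> nonnbrs x = X :&: B u ->
  2 <= #|nonnbrs v'| -> False.
Proof.
move=> q2 EW Ex n2; have [cY dW] := twin_cards.
have wW : w \in W by rewrite EW set11.
have wX := twin_W_X wW; have wY := core_notY uY xY pet (core_W u x wW).
have v'X := twin_v'_X.
have v'Y : v' \in Y by rewrite !inE eqxx orbT.
have EXY : X :&: Y = [set v'].
  have /cards1P[z Ez] : #|X :&: Y| == 1 by move: cY q2; card_lia.
  have : v' \in X :&: Y by rewrite inE v'X.
  by rewrite Ez => /set1P ->.
have uc := core_u u x W; have xc := core_v u x W; have wc := core_W u x wW.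
have inBu z : z \in X -> z != x -> z != w -> z != v' -> z \in B u.
  move=> zX zx zw zv'; have zY : z \notin Y.
    apply/negP => zY; have : z \in X :&: Y by rewrite inE zX.
    by rewrite EXY in_set1 (negPf zv').
  case: (petal_cover pet zY) => [E|E|zW|[t tc zB]].
  - by have := X_notO zX; rewrite E uO.
  - by rewrite E eqxx in zx.
  - by move: zW; rewrite EW in_set1 (negPf zw).
  have [E|tu] := eqVneq t u; first by rewrite -E.
  by have := twin_petal_R tc tu zB; rewrite in_setC in_setU zX orbT.
have nwB z : z \in B u -> ~~ e z w.
  move=> zB; apply/negP => ezw; have E := core_petal uY xY pet uc wc zB ezw.
  by have := u_notW e_irr pet; rewrite -E wW.
have wu : w != u by apply/eqP => E; have := X_notO wX; rewrite E uO.
have oddw := petals_odd pet wW.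
have [ewv'|nwv'] := boolP (e w v').
  move: (U); rewrite /= !inE !negb_or !andbT -!andbA => /and5P[n1 n2' n3 n4 /andP[n5 n6]].
  have wv' := rel_neq e_irr ewv'.
  have U' : uniq [:: w; v'; y1; y2] by move: wY => wY'; neq.
  have := ext2 (C := B w) e_irr ext_pm ewv' ey12 U'.
  rewrite oddw => H; apply/negP: isT; apply: H.
    rewrite disjoints_subset; apply/subsetP => z zB; rewrite in_setC.
    have zY := petal_notY pet wc zB.
    have zw : z != w by apply: contraTneq (petal_notcore pet wc zB) => ->; rewrite wc.
    by neq.
  apply: boundary_sub => y z yB eyz.
  have yR := twin_petal_R wc wu yB.
  have zv : z != v.
    by apply: contraTneq eyz => ->; rewrite e_sym; exact: (O_R vO yR).
  case: (petal_nbr pet wc yB eyz) => [|->|zY]; [by left|by right; rewrite !inE eqxx|right].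
  by move: zY; rewrite !inE (negPf zv) /= => /orP[/orP[]|] ->; rewrite ?orbT.
have sub : nonnbrs v' \subset [set w].
  apply/subsetP => z; rewrite in_nonnbrs in_set1 => /and3P[zX zv' nz].
  apply: contraT => zw.
  have [E|zx] := eqVneq z x.
    have : v' \in nonnbrs x by rewrite in_nonnbrs v'X -E eq_sym zv' e_sym.
    by rewrite Ex in_setI => /andP[_ /(petal_notY pet uc)]; rewrite v'Y.
  have zB := inBu z zX zx zw zv'.
  have adj t : t \in X -> e u t by case/twin_boundary5.2.
  have wv' : w != v' by apply: contraNneq wY => ->.
  case: (no_claw claw (adj w wX) (adj v' v'X) (adj z zX)) => //; rewrite 1?eq_sym //.
  by rewrite e_sym; apply: nwB.
by move/subset_leq_card: sub; rewrite cards1 leqNgt n2.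
Qed.

(* [B x] and [R :&: B u] are both even, and each vertex of [X :&: Y = {p, q}]
   touches only one of them; so one of them is cut off by three vertices, two
   of which are adjacent. *)
Lemma twin_one : #|R :&: Y| = 1 -> W = set0 -> nonnbrs x = X :&: B u -> #|nonnbrs x| = 2 ->
  (forall z, z \in X -> 2 <= #|nonnbrs z|) -> False.
Proof.
move=> q1 EW Ex a2 nn2; have [cY dW] := twin_cards.
have uc := core_u u x W; have xc := core_v u x W.
have /cards2P[p [q [npq EXY]]] : #|X :&: Y| == 2 by move: cY q1; card_lia.
have /cards1P[s ERY] : #|R :&: Y| == 1 by rewrite q1.
have /setIP[pX pY] : p \in X :&: Y by rewrite EXY set21.
have /setIP[qX qY] : q \in X :&: Y by rewrite EXY set22.
have /cards2P[x1 [x2 [n12 Ex12]]] : #|nonnbrs x| == 2 by rewrite a2.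
have x1n : x1 \in nonnbrs x by rewrite Ex12 set21.
have x2n : x2 \in nonnbrs x by rewrite Ex12 set22.
have ex12 := nonnbrs_adj x1n x2n xX n12.
have exY z : z \in X -> z \in Y -> e x z.
  move=> zX zY; apply: contraT => nz; have : z \in nonnbrs x.
    by rewrite in_nonnbrs zX nz andbT; apply: contraTneq zY => ->.
  by rewrite Ex in_setI => /andP[_ /(petal_notY pet uc)]; rewrite zY.
have nuY : #|u |: Y| = 5 by rewrite cardsU1 uY card_Y4.
have xu : x != u by rewrite eq_sym; apply: (rel_neq e_irr).
(* Otherwise, [W] being empty, the neighbours of [x] would lie in the five-set [u |: Y]. *)
have Bx : B x != set0.
  apply/eqP => Bx; have : nbrs e x \subset u |: Y.
    apply/subsetP => z; rewrite in_nbrs in_setU1 => exz.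
    have [zY|zY] := boolP (z \in Y); first by rewrite orbT.
    case: (petal_cover pet zY) => [->|E|zW|[t tc zB]]; rewrite ?eqxx //.
    - by move: exz; rewrite E e_irr.
    - by move: zW; rewrite EW inE.
    rewrite e_sym in exz; have E := core_petal uY xY pet tc xc zB exz.
    by move: zB; rewrite -E Bx inE.
  by move/subset_leq_card; rewrite nuY leqNgt deg6.
have x1X : x1 \in X by move: x1n; rewrite in_nonnbrs => /andP[].
have /setIP[_ x1B] : x1 \in X :&: B u by rewrite -Ex.
(* Otherwise [B u] is [{x1, x2}], and the neighbours of [x1] are among [x2], [u] and [Y]: at most
   six vertices, one of which is a second nonneighbour [n] of [x1] in [X]. *)
have RBu : R :&: B u != set0.
  apply/eqP => F2.
  have BuE : B u \subset nonnbrs x.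
    rewrite Ex; apply/subsetP => z zB; rewrite inE zB andbT; apply: contraT => zX.
    have : z \in R :&: B u by rewrite inE zB in_setC in_setU negb_or zX (twin_petal_notO uc zB).
    by rewrite F2 inE.
  have Sx2 z : z \in B u -> z != x1 -> z = x2.
    by move=> /(subsetP BuE); rewrite Ex12 => /set2P[->|//]; rewrite eqxx.
  have [n nN nx] : exists2 n, n \in nonnbrs x1 & n != x.
    have := nn2 x1 x1X; rewrite (cardsD1 x) => lt.
    have /card_gt0P[n] : 0 < #|nonnbrs x1 :\ x|.
      by move: lt; case: (x \in _); card_lia.
    by case/setD1P=> nx nN; exists n.
  move: nN; rewrite in_nonnbrs => /and3P[nX nx1 nxn].
  pose S := x2 |: (u |: Y).
  have subS : nbrs e x1 \subset S :\ n.
    apply/subsetP => z; rewrite in_nbrs => ezx; rewrite in_setD1; apply/andP; split.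
      by apply: contraNneq nxn => <-.
    rewrite /S in_setU1 in_setU1; case: (petal_nbr pet uc x1B ezx) => [zB|->|->].
    - by rewrite (Sx2 z zB) ?eqxx // eq_sym; apply: (rel_neq e_irr).
    - by rewrite eqxx orbT.
    by rewrite !orbT.
  have nS : n \in S.
    rewrite /S in_setU1 in_setU1; have [nY|nY] := boolP (n \in Y); first by rewrite !orbT.
    case: (petal_cover pet nY) => [->|E|nW|[t tc nB]].
    - by rewrite eqxx orbT.
    - by rewrite E eqxx in nx.
    - by move: nW; rewrite EW inE.
    have [E|tu] := eqVneq t u; first by rewrite E in nB; rewrite (Sx2 n nB) // eqxx.
    by have := twin_petal_R tc tu nB; rewrite in_setC in_setU nX orbT.
  have := subset_leq_card subS; have := cardsD1 n S; rewrite nS /=.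
  have : #|S| <= 6 by rewrite /S cardsU1 nuY; case: (_ \notin _).
  have := deg6 x1; card_lia.
pose f t := R :&: B t.
have Yin z t : t \in core -> z \in boundary e (f t) -> z \in Y -> z \in [set p; q; s].
  move=> tc zb zY; have := subsetP (twin_region_boundary tc) z zb.
  rewrite in_setU => /orP[zX|].
    have : z \in X :&: Y by rewrite inE zX.
    by rewrite EXY !inE => /orP[]->; rewrite ?orbT.
  by rewrite ERY !inE => ->; rewrite !orbT.
have fsub t z : t \in core -> z \in boundary e (f t) ->
    [\/ z \in [set p; q; s], z = t | z \in X :&: B t].
  move=> tc zb; have /boundaryP[zf [y /setIP[yR yB] eyz]] := zb.
  case: (petal_nbr pet tc yB eyz) => [zB|->|zY]; [|by constructor 2|by constructor 1; apply: Yin zb zY].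
  constructor 3; rewrite inE zB andbT; apply: contraT => zX.
  by case/negP: zf; rewrite inE zB in_setC in_setU negb_or zX (twin_petal_notO tc zB).
have b3 t : t \in core -> f t != set0 -> 3 <= #|boundary e (f t)|.
  move=> tc f0; apply: (boundary_ge3 (z := u) e_sym e_irr ext_pm conn evT deg6 f0).
    by rewrite inE in_setC in_setU uO.
  apply/negP => /boundaryP[_ [y /setIP[yR _] eyu]].
  by have := O_R uO yR; rewrite e_sym eyu.
have sepf : separated e core f by apply: (petal_separated pet (subxx _)) => t; apply: subsetIr.
have one z : z \in X -> z \in boundary e (f x) -> z \in boundary e (f u) -> False.
  move=> zX z1 z2; have := mult_X (O := O) (z := z) e_sym claw sepf.
  have fR i : i \in core -> f i \subset R by move=> _; apply: subsetIl.
  move=> /(_ fR zX); rewrite leqNgt => /negP; apply.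
  by apply/card_gt1P; exists x, u; split; rewrite // inE ?xc ?uc.
have fxE : f x = B x.
  by apply/setIidPr/subsetP => z; apply: (twin_petal_R xc xu).
have evx : ~~ odd #|f x| by rewrite fxE; apply: (petals_even pet); rewrite set22.
have evu : ~~ odd #|f u| by rewrite odd_petal_u -Ex a2.
have fx0 : f x != set0 by rewrite fxE.
have ux z : z \in boundary e (f u) -> z != u.
  by apply: contraTneq => ->; apply/negP => /boundaryP[_ [y /setIP[yR _] eyu]]; have := O_R uO yR; rewrite e_sym eyu.
have XBx z : z \in X :&: B x -> False.
  by case/setIP=> zX zB; have := twin_petal_R xc xu zB; rewrite in_setC in_setU zX orbT.
(* If [r'] does not touch the part at [x], that part is cut off by [s] and the adjacent vertices [x]
   and [r]. *)
have sub3 r r' : [set r; r'] = [set p; q] -> r' \notin boundary e (f x) -> e x r -> False.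
  move=> Er nr' exr; apply: (no_even_cut3 (s := s) evx (b3 x xc fx0) _ exr).
  apply/subsetP => z zb; case: (fsub x z xc zb) => [zpq|->|/XBx//]; last by rewrite !inE eqxx.
  move: zpq; rewrite -Er !inE -!orbA => /or3P[->|/eqP E|->]; rewrite ?orbT //.
  by rewrite E (negPf nr') in zb.
have [pb|pb] := boolP (p \in boundary e (f x)); last first.
  by apply: (sub3 q p) => //; [rewrite setUC|apply: exY].
have [qb|qb] := boolP (q \in boundary e (f x)); last first.
  by apply: (sub3 p q) => //; apply: exY.
(* Now [p] and [q] both touch the part at [x], hence not the one at [u], which is cut off by [s] and
   the adjacent vertices [x1] and [x2]. *)
apply: (no_even_cut3 (s := s) evu (b3 u uc RBu) _ ex12).
apply/subsetP => z zb; case: (fsub u z uc zb) => [|E|]; last 1 first.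
- by rewrite -Ex Ex12 !inE => /orP[]->; rewrite ?orbT.
- rewrite !inE -!orbA => /or3P[/eqP E|/eqP E|->]; rewrite ?orbT //; rewrite E in zb.
    by case: (one p pX pb zb).
  by case: (one q qX qb zb).
by have := ux z zb; rewrite E eqxx.
Qed.

End TwinEdge.
(** Being adjacent to both [u] and [x], the twin [v] lies in no petal. In [W] it would have a
    neighbour in its own petal; that vertex is in [X], hence also adjacent to the core vertex [u].
    So [v] is in the four-set, and the rest is relabelling. *)
Lemma twin_edge_forced x : x \in X -> exists v' y1 y2 W B,
  [/\ e v v', e y1 y2, uniq [:: v; v'; y1; y2],
      u \notin [set v; v'; y1; y2] & x \notin [set v; v'; y1; y2]] /\
  petals e (~: [set v; v'; y1; y2]) u x W B.
Proof.
move=> xX; have [eux evx] := twin_boundary5.2 x xX.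
have [a [b [c [d [W [B [[eab ecd U uY xY] pet]]]]]]] := bad eux.
have uc := core_u u x W; have xc := core_v u x W.
have nux := rel_neq e_irr eux.
have vY : v \in [set a; b; c; d].
  apply: contraT => vY; case: (petal_cover pet vY) => [E|E|vW|[t tc vB]].
  - by move: euv; rewrite E e_irr.
  - by move: evx; rewrite E e_irr.
  - have vc := core_W u x vW; have [z zB evz] := petals_touch pet vW.
    have zu : z != u by apply: contraNneq (petal_notcore pet vc zB) => ->.
    case: (twin_nbr vO evz) => [/set2P[] E|zX].
    + by rewrite E eqxx in zu.
    + by move: evz; rewrite E e_irr.
    have [euz _] := twin_boundary5.2 z zX; rewrite e_sym in euz.
    have E := core_petal uY xY pet vc uc zB euz.
    by move: nuv; rewrite E eqxx.
  have evu : e v u by rewrite e_sym.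
  have Eu := core_petal uY xY pet tc uc vB evu.
  have Ex := core_petal uY xY pet tc xc vB evx.
  by move: nux; rewrite Eu Ex eqxx.
have goal v' y1 y2 : [set v; v'; y1; y2] = [set a; b; c; d] -> e v v' -> e y1 y2 ->
    uniq [:: v; v'; y1; y2] -> exists v' y1 y2 W B,
    [/\ e v v', e y1 y2, uniq [:: v; v'; y1; y2],
      u \notin [set v; v'; y1; y2] & x \notin [set v; v'; y1; y2]] /\
    petals e (~: [set v; v'; y1; y2]) u x W B.
  by move=> EY evv' ey U'; exists v', y1, y2, W, B; rewrite EY.
move: vY; rewrite !inE -!orbA => /or4P[]/eqP Ev; rewrite -Ev in eab ecd U goal.
- by apply: (goal b c d).
- apply: (goal a c d) => //; [by rewrite [[set v; a]]setUC|by rewrite e_sym|by neq].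
- apply: (goal d a b) => //; last by neq.
  by apply/setP => z; rewrite !inE; case: (z == a); case: (z == b); case: (z == v); case: (z == d).
apply: (goal c a b) => //; [|by rewrite e_sym|by neq].
by apply/setP => z; rewrite !inE; case: (z == a); case: (z == b); case: (z == v); case: (z == c).
Qed.

Lemma twin_touch_nonnbrs x r : x \in X -> r \in R -> e x r -> 2 <= #|nonnbrs x|.
Proof.
move=> xX rR exr.
have [v' [y1 [y2 [W [B [[evv' ey12 U uY xY] pet]]]]]] := twin_edge_forced xX.
apply: leq_trans (twin_nonnbrs_ge2 xX U uY xY pet rR exr) _.
by apply: subset_leq_card; apply: petal_u_nonnbrs pet.
Qed.

Lemma nonnbrs_sym x y : x \in X -> y \in nonnbrs x -> x \in nonnbrs y.
Proof. by move=> xX; rewrite !in_nonnbrs xX eq_sym e_sym => /and3P[_ -> ->]. Qed.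

(** Apart from [u] and [v], only the four other vertices of [X] can be neighbours of [x], and degree
    six needs them all. *)
Lemma untouched_universal x : x \in X -> (forall r, r \in R -> ~~ e x r) -> nonnbrs x = set0.
Proof.
move=> xX nr; apply/eqP; rewrite -cards_eq0 -leqn0.
have c1 : #|nbrs e x :|: nonnbrs x| <= 6.
  apply: (@leq_trans #|O :|: (X :\ x)|).
    apply/subset_leq_card/subsetP => z; rewrite !in_setU in_setD1 in_nbrs in_nonnbrs => /orP[exz|/and3P[-> -> _]]; last by rewrite !orbT.
    have -> : z != x by apply: contraTneq exz => ->; rewrite e_irr.
    have := nr z; rewrite in_setC !in_setU negb_or exz.
    by case: (_ || _) => //=; case: (z \in X) => // /(_ isT).
  apply: leq_trans (leq_card_setU _ _) _; rewrite cards2 nuv.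
  have := cardsD1 x X; rewrite xX twin_boundary5.1; card_lia.
have : #|nbrs e x :|: nonnbrs x| = #|nbrs e x| + #|nonnbrs x|.
  by apply/eqP; rewrite (leq_card_setU _ _).2 disjoint_sym disjoints_subset; apply/subsetP => z /setDP[_]; rewrite in_setC.
have := deg6 x; move: c1; card_lia.
Qed.

(* If [x] is adjacent to all of [X] and to nothing in [R], a matching of
   [X - x] isolates the odd set [{u, v, x}]. *)
Lemma nonnbrs_ge2 x : x \in X -> 2 <= #|nonnbrs x|.
Proof.
move=> x0X; rewrite leqNgt; apply/negP => lt2.
have nr r : r \in R -> ~~ e x r.
  by move=> rR; apply/negP => /(twin_touch_nonnbrs x0X rR); rewrite leqNgt lt2.
have un := untouched_universal x0X nr.
have touchy y : y \in X -> nonnbrs y != set0 -> 2 <= #|nonnbrs y|.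
  move=> yX n0; case: (boolP [exists r in R, e y r]) => [/exists_inP[r rR eyr]|/exists_inPn nry].
    exact: twin_touch_nonnbrs eyr.
  by rewrite (untouched_universal yX nry) eqxx in n0.
(* By connectivity some [t] in [X] has a neighbour in [R]; its nonneighbours [n1] and [n2] form the
   first edge of the matching. *)
have [t tX t2] : exists2 t, t \in X & 2 <= #|nonnbrs t|.
  have [r rR] := rest_ex fragO.
  have [RT|] := eqVneq (boundary e R) set0.
    have R0 : R != set0 by apply/set0Pn; exists r.
    have uR : u \in R by rewrite (conn R0 RT) inE.
    by have := R_notO uR; rewrite uO.
  case/set0Pn=> t /boundaryP[tR [r' r'R er't]]; have etr' : e t r' by rewrite e_sym.
  have tO : t \notin O by apply/negP => tO; have := O_R tO r'R; rewrite etr'.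
  have tX : t \in X by move: tR; rewrite in_setC in_setU negbK (negPf tO).
  by exists t => //; apply: (twin_touch_nonnbrs tX r'R).
have /card_gt1P[n1 [n2 [n1N n2N n12]]] := t2.
have inX y z : y \in nonnbrs z -> y \in X by rewrite in_nonnbrs => /and3P[].
have en12 := nonnbrs_adj n1N n2N tX n12.
have tN1 := nonnbrs_sym tX n1N.
have := touchy n1 (inX _ _ n1N) => /(_ _)/card_gt1P[|s1 [s2 [s1N s2N s12]]]; first by apply/set0Pn; exists t.
(* A second nonneighbour [s] of [n1] is adjacent to [t], and [st] is the other edge of the
   matching. *)
have [s sN st] : exists2 s, s \in nonnbrs n1 & s != t.
  have [E|] := eqVneq s1 t; last by exists s1.
  by exists s2; rewrite // -E eq_sym.
have est := nonnbrs_adj sN tN1 (inX _ _ n1N) st.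
have ne y z : y \in nonnbrs z -> y != z by rewrite in_nonnbrs => /and3P[].
have nadj y z : y \in nonnbrs z -> ~~ e z y by rewrite in_nonnbrs => /and3P[].
have nex y z : z \in X -> y \in nonnbrs z -> x != y /\ x != z.
  move=> zX yN; split; apply/eqP => E.
    have := nonnbrs_sym zX yN; rewrite -E un inE //.
  by move: yN; rewrite -E un inE.
have [xn1 xt] := nex _ _ tX n1N; have [xn2 _] := nex _ _ tX n2N.
have [xs _] := nex _ _ (inX _ _ n1N) sN.
have n1t := ne _ _ n1N; have n2t := ne _ _ n2N; have sn1 := ne _ _ sN.
have sn2 : s != n2 by apply: contraNneq (nadj _ _ sN) => ->.
have U : uniq [:: s; t; n1; n2] by neq.
have sX := inX _ _ sN; have n1X := inX _ _ n1N; have n2X := inX _ _ n2N.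
pose Y := [set s; t; n1; n2].
have xY : x \notin Y by rewrite /Y; neq.
have EX : X = x |: Y.
  apply/eqP; rewrite eq_sym eqEcard twin_boundary5.1 cardsU1 xY card_Y4 // andbT.
  apply/subsetP => z; rewrite !in_setU !in_set1 -!orbA.
  by case/or4P=> [/eqP->|/eqP->|/eqP->|/orP[]/eqP->].
have xO := X_notO x0X.
have : ~~ odd #|x |: O|; last by rewrite cardsU1 xO cards2 nuv.
apply: (ext2 e_irr ext_pm est en12 U).
  rewrite disjoints_subset; apply/subsetP => z /setU1P[->|zO]; first by rewrite in_setC.
  rewrite in_setC; apply: contraL zO => zY; apply: X_notO.
  by rewrite EX in_setU1 zY orbT.
apply: boundary_sub => y z yC eyz; rewrite in_setU1.
have [->|zx] := eqVneq z x; first by left.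
have [zO|zO] := boolP (z \in O); [by left|right].
suff : z \in X by rewrite EX in_setU1 (negPf zx).
case/setU1P: yC => [E|yO]; last by case: (boundary_or yO eyz) => //; rewrite (negPf zO).
apply: contraT => zX; have zR : z \in R by rewrite in_setC in_setU negb_or zO.
by have := nr z zR; rewrite -E eyz.
Qed.

Lemma no_twins : False.
Proof.
(* If [x] has three nonneighbours in [X], they are pairwise adjacent, so [n1] has at most two of its
   own. *)
have [x xX x2] : exists2 x, x \in X & #|nonnbrs x| <= 2.
  have [x xX] : exists x, x \in X by apply/card_gt0P; rewrite twin_boundary5.1.
  have [le2|] := leqP #|nonnbrs x| 2; first by exists x.
  case/card_gt2P=> [n1 [n2 [n3 [[n1N n2N n3N] [n12 n23 n31]]]]].
  have inX y : y \in nonnbrs x -> y \in X by rewrite in_nonnbrs => /and3P[].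
  exists n1; first exact: inX.
  have e12 := nonnbrs_adj n1N n2N xX n12.
  have n13 : n1 != n3 by rewrite eq_sym.
  have e13 := nonnbrs_adj n1N n3N xX n13.
  have sub : nonnbrs n1 \subset X :\ n1 :\ n2 :\ n3.
    apply/subsetP => z; rewrite in_nonnbrs !in_setD1 => /and3P[-> -> nz]; rewrite !andbT.
    by apply/andP; split; apply: contraNneq nz => ->.
  apply: leq_trans (subset_leq_card sub) _.
  have := cardsD1 n1 X; have := cardsD1 n2 (X :\ n1); have := cardsD1 n3 (X :\ n1 :\ n2).
  rewrite !in_setD1 (inX _ n1N) (inX _ n2N) (inX _ n3N) [n2 == _]eq_sym n12 [n3 == n2]eq_sym n23 n31 /= twin_boundary5.1.
  card_lia.
have a2 : #|nonnbrs x| = 2 by apply/eqP; rewrite eqn_leq x2 nonnbrs_ge2.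
have [v' [y1 [y2 [W [B [[evv' ey12 U uY xY] pet]]]]]] := twin_edge_forced xX.
have [cY dW] := twin_cards xX U uY xY pet.
have [r rR exr] : exists2 r, r \in R & e x r.
  apply/exists_inP; apply: contraT => /exists_inPn nr.
  by move: a2; rewrite (untouched_universal xX nr) cards0.
have ge2 := twin_nonnbrs_ge2 xX U uY xY pet rR exr.
have sub := petal_u_nonnbrs xX uY xY pet.
have Ex : nonnbrs x = X :&: B u by apply/esym/eqP; rewrite eqEcard sub a2.
have v'X := twin_v'_X evv' uY.
have v'Y : 0 < #|X :&: [set v; v'; y1; y2]|.
  by apply/card_gt0P; exists v'; rewrite inE v'X !inE eqxx orbT.
rewrite -Ex a2 in dW.
(* The count is now [#|W| + 2 = 1 + #|R :&: Y|]; since [v'] lies in [X :&: Y], [#|R :&: Y|] is one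
   or two. *)
have [q2|nq2] := eqVneq #|R :&: [set v; v'; y1; y2]| 2.
  have /cards1P[w Ew] : #|W| == 1 by move: dW q2; card_lia.
  exact: (twin_two xX evv' ey12 U uY xY pet q2 Ew Ex (nonnbrs_ge2 v'X)).
have q1 : #|R :&: [set v; v'; y1; y2]| = 1 by move: dW cY v'Y nq2 => + + + /eqP; card_lia.
have W0 : W = set0 by apply/eqP; rewrite -cards_eq0; apply/eqP; move: dW q1; card_lia.
exact: (twin_one xX U uY xY pet q1 W0 Ex a2 nonnbrs_ge2).
Qed.

End Twins.

(** * Edge deletion *)

(** Deciding [pm] allows a failing pair of edges to be extracted from the negation of
    extendability. *)
Lemma pmP (T : finType) (r : rel T) (A : {set T}) :
  reflect (pm r A) [exists m : {ffun T -> T}, [forall x in A,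
    [&& m x \in A, m (m x) == x & r x (m x)]]].
Proof.
apply: (iffP existsP) => [[m /forall_inP H]|[m H]].
  by exists m => x /H /and3P[-> /eqP-> ->].
exists [ffun x => m x]; apply/forall_inP => x xA; rewrite !ffunE.
by have [-> -> ->] := H x xA; rewrite eqxx.
Qed.

Section Deletion.
Variables (T : finType) (e : rel T).
Hypotheses (e_sym : symmetric e) (e_irr : irreflexive e).
Hypothesis ext_pm : forall a b c d, e a b -> e c d -> uniq [:: a; b; c; d] ->
  pm e (~: [set a; b; c; d]).
Hypothesis conn : forall F : {set T}, F != set0 -> boundary e F = set0 -> F = [set: T].
Hypothesis claw : clawless e [set: T].
Hypothesis T6 : 6 <= #|T|.
Hypothesis evT : ~~ odd #|T|.
Hypothesis deg6 : forall x, 6 <= #|nbrs e x|.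

(** If [uv] were a bridge, an end of it would be a cut vertex, since it has a neighbour besides the
    other end. *)
Lemma del_edge_connected u v : e u v -> connected (del_edge e [set u; v]).
Proof.
set r := del_edge _ _ => euv; apply/forallP => x; apply/forallP => y.
pose A := [set z | connect r x z].
suff -> : connect r x y = (y \in [set: T]) by rewrite inE.
suff <- : A = [set: T] by rewrite inE.
have A0 : A != set0 by apply/set0Pn; exists x; rewrite inE connect0.
have stepA z w : z \in A -> r z w -> w \in A.
  by rewrite !inE => xz rzw; apply: connect_trans xz (connect1 rzw).
have cut p q : [set u; v] = [set p; q] -> e p q -> p \in A -> q \notin A -> A = [set: T].
  move=> Epq epq pA qA; have rE : r = del_edge e [set p; q] by rewrite /r Epq.
  have cross z w : z \in A -> w \notin A -> e z w -> z = p /\ w = q.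
    move=> zA wA ezw; have : ~~ r z w by apply: contra wA; apply: stepA.
    rewrite rE del_edgeE ezw /= negbK => /orP[]/andP[/eqP Ez /eqP Ew] //.
    by rewrite -Ez zA in qA.
  have bA : boundary e A \subset [set q].
    apply: boundary_sub => z w zA ezw; have [|wA] := boolP (w \in A); [by left|right].
    by have [_ ->] := cross z w zA wA ezw; rewrite set11.
  have [w eqw wp] : exists2 w, e q w & w \notin [set p].
    by apply: (nbr_avoiding deg6); rewrite cards1.
  have wA : w \notin A.
    apply: contra wp => wA; rewrite in_set1; rewrite e_sym in eqw.
    by have [-> _] := cross w q wA qA eqw.
  have wq : w != q by rewrite eq_sym; apply: (rel_neq e_irr).
  by case: (no_cut1 e_sym e_irr ext_pm conn evT deg6 A0 bA qA wA wq).
have [uA|uA] := boolP (u \in A); have [vA|vA] := boolP (v \in A).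
- apply: conn => //; apply/eqP; rewrite -subset0; apply: boundary_sub => z w zA ezw; left.
  have [E|E] := boolP ((z == u) && (w == v) || (z == v) && (w == u)).
    by case/orP: E => /andP[_ /eqP->].
  by apply: (stepA z) => //; rewrite /r del_edgeE ezw.
- exact: (cut u v).
- by apply: (cut v u) => //; rewrite 1?setUC // e_sym.
apply: conn => //; apply/eqP; rewrite -subset0; apply: boundary_sub => z w zA ezw; left.
apply: (stepA z) => //; rewrite /r del_edgeE ezw; apply/negP => /orP[]/andP[/eqP E _].
  by rewrite -E zA in uA.
by rewrite -E zA in vA.
Qed.

Lemma nonextendable_deletion u v : e u v -> ~~ extendable (del_edge e [set u; v]) 2 ->
  exists a b c d, [/\ e a b, e c d, uniq [:: a; b; c; d] &
    ~ pm (del_edge e [set u; v]) (~: [set a; b; c; d])].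
Proof.
set r := del_edge _ _ => euv nex.
have r_sym : symmetric r := del_edge_sym e_sym _.
have r_irr : irreflexive r := del_edge_irr e_irr _.
have rE a b : r a b -> e a b by rewrite /r del_edgeE => /andP[].
pose P (p : T * T * T * T) := let: (a, b, c, d) := p in
  [&& r a b, r c d, uniq [:: a; b; c; d] &
   ~~ [exists m : {ffun T -> T}, [forall x in ~: [set a; b; c; d],
    [&& m x \in ~: [set a; b; c; d], m (m x) == x & r x (m x)]]]].
case: (boolP [exists p, P p]) => [/existsP[[[[a b] c] d] /and4P[rab rcd U /pmP npm]]|nP].
  by exists a, b, c, d; split=> //; apply: rE.
case/negP: nex.
have all_pm a b c d : r a b -> r c d -> uniq [:: a; b; c; d] -> pm r (~: [set a; b; c; d]).
  move=> rab rcd U; apply/pmP; apply: contraT => npm; case/negP: nP.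
  by apply/existsP; exists (a, b, c, d); apply/and4P.
apply: extendable2_intro => //; first exact: del_edge_connected.
(* The disjoint edges [ab] and [cd] survive the deletion because [a] and [c] avoid [u] and [v];
   extending them gives a perfect matching of the whole graph. *)
have sz2 : #|[set u; v]| < 6 by rewrite cards2; case: (_ != _).
have [a _ auv] := nbr_avoiding deg6 u sz2.
have [b eab buv] := nbr_avoiding deg6 a sz2.
have sz4 : #|[set u; v; a; b]| < 6.
  by rewrite -!setUA !cardsU1 cards1; do 3 case: (_ \notin _).
have [c _ cS] := nbr_avoiding deg6 a sz4.
have [d ecd dS] := nbr_avoiding deg6 c sz4.
have nab := rel_neq e_irr eab; have ncd := rel_neq e_irr ecd.
have U : uniq [:: a; b; c; d] by neq.
have avoid p q : e p q -> p \notin [set u; v] -> r p q.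
  by move=> epq; rewrite !inE negb_or => /andP[/negPf pu /negPf pv]; rewrite /r del_edgeE epq pu pv.
have rab := avoid _ _ eab auv.
have cuv : c \notin [set u; v] by neq.
have rcd := avoid _ _ ecd cuv.
apply: (pm_add r_sym r_irr (in_setT a) (in_setT b) rab).
apply: (pm_add r_sym r_irr (x := c) (y := d)) => //; [by neq|by neq|].
have -> : [set: T] :\: [set a; b] :\: [set c; d] = ~: [set a; b; c; d].
  by apply/setP => z; rewrite !inE !negb_or andbT andbC -!andbA.
exact: all_pm.
Qed.

Lemma minimal_edges_forced :
  (forall u v, e u v -> ~~ extendable (del_edge e [set u; v]) 2) -> edges_forced e.
Proof.
move=> nex u v euv.
have [a [b [c [d [eab ecd U npm]]]]] := nonextendable_deletion euv (nex u v euv).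
have pmY := ext_pm eab ecd U.
(* If the four-set contained an end of [uv], the deletion would not change the graph outside it, and
   the perfect matching there would survive. *)
have agree s : s \in [set u; v] -> s \notin [set a; b; c; d].
  move=> suv; apply/negP => sY; apply: npm; apply: pm_sub_rel pmY => x y.
  rewrite !in_setC => xY yY exy; rewrite del_edgeE exy /=.
  have nx : x != s by apply: contraNneq xY => ->.
  have ny : y != s by apply: contraNneq yY => ->.
  by case/set2P: suv nx ny => -> /negPf-> /negPf->; rewrite ?andbF.
have uY := agree u (set21 u v); have vY := agree v (set22 u v).
have [||W [B pet]] := forced_petals e_sym e_irr claw _ _ euv pmY npm; rewrite ?in_setC //.
by exists a, b, c, d, W, B.
Qed.

Lemma edges_not_forced : edges_forced e -> False.
Proof.
move=> bad.
have [x0 _] : exists x0 : T, x0 \in T by apply/card_gt0P; apply: leq_trans T6.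
have [F0 fragF0] := fragment_ex e_irr deg6 x0 bad.
case: (@arg_minnP _ F0 (fragment e) (fun F : {set T} => #|F|) fragF0) => O fragO minO.
have [u [v [EO euv]]] :=
  minimal_fragment_pair e_sym e_irr ext_pm conn claw evT deg6 bad fragO minO.
rewrite EO in fragO.
exact: (no_twins e_sym e_irr ext_pm conn claw evT deg6 bad euv fragO).
Qed.

End Deletion.

Theorem theorem1p5 (T : finType) (e : rel T)
    (e_sym : symmetric e) (e_irr : irreflexive e)
    (e_min : minimal_extendable e 2) (e_claw : claw_free e) :
  min_degree e = 4 \/ min_degree e = 5.
Proof.
case/andP: e_min => ext2e /forall_inP nex.
have [pmT ext_pm] := extendable2_pm e_sym e_irr ext2e.
have /and5P[_ T6 con _ _] := ext2e.
have conn F : F != set0 -> boundary e F = set0 -> F = [set: T] by apply: connected_boundary.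
have claw := claw_free_clawless e_sym e_irr e_claw.
have ge4 : 4 <= min_degree e.
  apply: min_degree_ge => [|x]; first exact: leq_trans T6.
  exact: (degree_ge4 e_sym e_irr ext_pm conn claw T6 pmT).
suff le5 : min_degree e <= 5.
  by case: (ltngtP (min_degree e) 4) ge4 => // [lt _|->]; [right; apply/eqP; rewrite eqn_leq le5|left].
rewrite leqNgt; apply/negP => ge6.
have deg6 x : 6 <= #|nbrs e x| := leq_trans ge6 (min_degree_le e x).
have evT : ~~ odd #|T|.
  by rewrite -cardsT; apply: (all_evenP _ _ (pm_all_even e_irr pmT)); apply: closed_in_refl.
apply: (edges_not_forced e_sym e_irr ext_pm conn claw T6 evT deg6).
apply: (minimal_edges_forced e_sym e_irr ext_pm conn claw T6 evT deg6) => u v euv.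
by apply: nex; apply/edgesP; exists u, v.
Qed.
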